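(* Let $\Bbbk\to A\xrightarrow{\iota}B\xrightarrow{\pi}C\to\Bbbk$ be an exact sequence of Hopf algebras over a field $\Bbbk$, with $B$ faithfully coflat as a right $C$-comodule (via $(\mathrm{id}\otimes\pi)\Delta$). Identify $A$ with $\iota(A)\subseteq B$. (i) There is a nonzero left integral $\int$ for $B$ such that $\int|_A\neq0$ if and only if $A$ is co-Frobenius and $C$ is cosemisimple. (ii) $B$ is cosemisimple if and only if $A$ and $C$ are cosemisimple.
   Context: A sequence of Hopf algebra maps $\Bbbk\to A\xrightarrow{\iota}B\xrightarrow{\pi}C\to\Bbbk$ is exact if $\iota$ is injective, $\pi$ is surjective, $\ker\pi=B\iota(A)^+$ (with $A^+=\ker\varepsilon_A$), and $\{b\in B:(\mathrm{id}\otimes\pi)\Delta(b)=b\otimes1\}=\iota(A)$. A left integral for a Hopf algebra $L$ is a linear map $\int:L\to\Bbbk$ with $\int(h_{(2)})h_{(1)}=\int(h)1_L$ for all $h\in L$; $L$ is co-Frobenius if it has a nonzero left integral. *)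

(* Defs.v *)
From HB Require Import structures.
From mathcomp Require Import all_boot all_order all_algebra.
Set Implicit Arguments. Unset Strict Implicit. Unset Printing Implicit Defensive.
Import Order.TTheory GRing.Theory.
Local Open Scope ring_scope.

Section HopfDefs.
Variable F : fieldType.

Definition lin (U V : lmodType F) (f : U -> V) : Prop :=
  forall (a : F) (x y : U), f (a *: x + y) = a *: f x + f y.
Definition linF (U : lmodType F) (f : U -> F) : Prop :=
  forall (a : F) (x y : U), f (a *: x + y) = a * f x + f y.

Definition bilin (U V : lmodType F) (phi : U -> V -> F) : Prop :=
  (forall v, linF (fun u => phi u v)) /\ (forall u, linF (phi u)).
Definition trilin (U V W : lmodType F) (phi : U -> V -> W -> F) : Prop :=
  (forall v w, linF (fun u => phi u v w)) /\ (forall u w, linF (fun v => phi u v w))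
  /\ (forall u v, linF (phi u v)).

Definition tev (U V : lmodType F) (phi : U -> V -> F) (t : seq (U * V)) : F :=
  \sum_(p <- t) phi p.1 p.2.
Definition teq (U V : lmodType F) (t1 t2 : seq (U * V)) : Prop :=
  forall phi : U -> V -> F, bilin phi -> tev phi t1 = tev phi t2.

Record hopf_axioms (B : algType F) (d : B -> seq (B * B)) (e : B -> F)
    (S : B -> B) : Prop := {
  hd_lin : forall phi : B -> B -> F, bilin phi -> linF (fun b => tev phi (d b));
  hd_coassoc : forall phi : B -> B -> B -> F, trilin phi -> forall b : B,
     \sum_(p <- d b) \sum_(q <- d p.1) phi q.1 q.2 p.2
     = \sum_(p <- d b) \sum_(q <- d p.2) phi p.1 q.1 q.2;
  he_lin : linF e;
  hcounit_l : forall b : B, \sum_(p <- d b) e p.1 *: p.2 = b;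
  hcounit_r : forall b : B, \sum_(p <- d b) e p.2 *: p.1 = b;
  hd_mul : forall phi : B -> B -> F, bilin phi -> forall x y : B,
     tev phi (d (x * y)) = \sum_(p <- d x) \sum_(q <- d y) phi (p.1 * q.1) (p.2 * q.2);
  hd_one : forall phi : B -> B -> F, bilin phi -> tev phi (d 1) = phi 1 1;
  he_mul : forall x y : B, e (x * y) = e x * e y;
  he_one : e 1 = 1;
  hS_lin : lin S;
  hS_l : forall b : B, \sum_(p <- d b) S p.1 * p.2 = (e b)%:A;
  hS_r : forall b : B, \sum_(p <- d b) p.1 * S p.2 = (e b)%:A }.

Record hopf := Hopf {
  hsort :> algType F;
  hdelta : hsort -> seq (hsort * hsort);
  heps : hsort -> F;
  hanti : hsort -> hsort;
  hax : hopf_axioms hdelta heps hanti }.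

(* morphisms of Hopf algebras (bialgebra maps; they automatically commute
   with the antipodes) *)
Definition hopf_map (A B : hopf) (f : A -> B) : Prop :=
  lin f /\ (forall x y : A, f (x * y) = f x * f y) /\ f 1 = 1 /\
  (forall a : A, heps (f a) = heps a) /\
  (forall phi : B -> B -> F, bilin phi -> forall a : A,
     tev phi (hdelta (f a)) = \sum_(p <- hdelta a) phi (f p.1) (f p.2)).

Definition rcoact (B C : hopf) (pi : B -> C) (b : B) : seq (B * C) :=
  [seq (p.1, pi p.2) | p <- hdelta b].

Definition rcoinv (B C : hopf) (pi : B -> C) (b : B) : Prop :=
  teq (rcoact pi b) [:: (b, 1)].

Definition exact_hopf_seq (A B C : hopf) (iota : A -> B) (pi : B -> C) : Prop :=
  hopf_map iota /\ hopf_map pi /\ injective iota /\ (forall c : C, exists b, pi b = c) /\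
   (forall b : B, pi b = 0 <->
      exists s : seq (B * A), (forall p, p \in s -> heps p.2 = 0) /\
                              b = \sum_(p <- s) p.1 * iota p.2) /\
   (forall b : B, rcoinv pi b <-> exists a : A, b = iota a).

Record lcomod_axioms (C : hopf) (M : lmodType F) (l : M -> seq (C * M)) : Prop := {
  lc_lin : forall phi : C -> M -> F, bilin phi -> linF (fun m => tev phi (l m));
  lc_coassoc : forall phi : C -> C -> M -> F, trilin phi -> forall m : M,
    \sum_(p <- l m) \sum_(q <- hdelta p.1) phi q.1 q.2 p.2
    = \sum_(p <- l m) \sum_(q <- l p.2) phi p.1 q.1 q.2;
  lc_counit : forall m : M, \sum_(p <- l m) heps p.1 *: p.2 = m }.

Record lcomod (C : hopf) := LComod {
  lcsort :> lmodType F;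
  lcoact : lcsort -> seq (C * lcsort);
  lcax : lcomod_axioms lcoact }.

Definition lcomod_map (C : hopf) (M N : lcomod C) (f : M -> N) : Prop :=
  lin f /\ forall m : M, teq (lcoact (f m)) [seq (p.1, f p.2) | p <- lcoact m].

Definition in_cotens (B C : hopf) (pi : B -> C) (M : lcomod C) (t : seq (B * M)) : Prop :=
  forall phi : B -> C -> M -> F, trilin phi ->
    \sum_(p <- t) \sum_(q <- rcoact pi p.1) phi q.1 q.2 p.2
    = \sum_(p <- t) \sum_(q <- lcoact p.2) phi p.1 q.1 q.2.

Definition tmap (B : lmodType F) (M N : lmodType F) (f : M -> N) (t : seq (B * M))
  : seq (B * N) := [seq (p.1, f p.2) | p <- t].

Definition exact_at (M1 M2 M3 : lmodType F) (f : M1 -> M2) (g : M2 -> M3) : Prop :=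
  (forall m, g (f m) = 0) /\ (forall m, g m = 0 -> exists m', f m' = m).

Definition exact_cotens (B C : hopf) (pi : B -> C) (M1 M2 M3 : lcomod C)
    (f : M1 -> M2) (g : M2 -> M3) : Prop :=
  (forall t, in_cotens pi t -> teq (tmap g (tmap f t)) [::]) /\
  (forall t, in_cotens pi t -> teq (tmap g t) [::] ->
     exists t', in_cotens pi t' /\ teq (tmap f t') t).

Definition faithfully_coflat (B C : hopf) (pi : B -> C) : Prop :=
  forall (M1 M2 M3 : lcomod C) (f : M1 -> M2) (g : M2 -> M3),
    lcomod_map f -> lcomod_map g -> (exact_at f g <-> exact_cotens pi f g).

Definition left_integral (L : hopf) (I : L -> F) : Prop :=
  linF I /\ forall h : L, \sum_(p <- hdelta h) I p.2 *: p.1 = I h *: 1.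

Definition co_frobenius (L : hopf) : Prop :=
  exists I : L -> F, left_integral I /\ exists h, I h <> 0.

(* subcoalgebras, simple subcoalgebras, cosemisimplicity
   (C is the sum -- necessarily direct -- of its simple subcoalgebras) *)
Definition subcoalg (C : hopf) (D : C -> Prop) : Prop :=
  D 0 /\ (forall (a : F) x y, D x -> D y -> D (a *: x + y)) /\
  forall d, D d -> exists t : seq (C * C),
     (forall p, p \in t -> D p.1 /\ D p.2) /\ teq t (hdelta d).

Definition simple_subcoalg (C : hopf) (D : C -> Prop) : Prop :=
  subcoalg D /\ (exists d, D d /\ d <> 0) /\
  forall E : C -> Prop, subcoalg E -> (forall x, E x -> D x) ->
     (forall x, E x -> x = 0) \/ (forall x, D x -> E x).

Definition cosemisimple (C : hopf) : Prop :=
  forall c : C, exists s : seq C,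
    (forall x, x \in s -> exists D, simple_subcoalg D /\ D x) /\ c = \sum_(x <- s) x.

End HopfDefs.

(* Main.v *)
(** Sweedler calculus over an arbitrary field: a Hopf algebra [H] is cosemisimple iff it has a
    right (equivalently a left) integral [J] with [J 1 = 1].  The integral makes every
    subcoalgebra a direct summand as a subcoalgebra; conversely it is the projection onto the
    line of [1] along a complementary subcoalgebra.  If [I] is a nonzero left integral then
    [I \o S] is a nonzero right integral.

    Integrals [IA] of [A] and [J] of [C] with [J 1 = 1] give the integral
    [b |-> IA (b_1 J (pi b_2))] of [B], which extends [IA].  Conversely, let [R] be a right
    integral of [B] with [R (iota a) = 1].  Then [b (x) m |-> R b *: m] sends the cotensor product
    of [B] and [M] to the coinvariants of [M], naturally in the left [C]-comodule [M], so
    coflatness makes taking coinvariants exact.  Applied to duals of finite-dimensional right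
    coideals of [C], this produces an integral of [C] with value [1] at [1]. *)
Require Import Defs.
From HB Require Import structures.
From mathcomp Require Import all_boot all_order all_algebra.
From mathcomp Require boolp classical_sets.
Set Implicit Arguments. Unset Strict Implicit. Unset Printing Implicit Defensive.
Import GRing.Theory.
Local Open Scope ring_scope.

(** * Linear algebra in infinite dimension *)

Section LinearAlgebra.
Variable F : fieldType.

Section Lin.
Variables (U V : lmodType F) (f : U -> V).
Hypothesis fL : lin f.

Lemma lin0 : f 0 = 0.
Proof. by have := fL (-1) 0 0; rewrite scaler0 addr0 scaleN1r addNr. Qed.

Lemma linD x y : f (x + y) = f x + f y.
Proof. by have := fL 1 x y; rewrite !scale1r. Qed.

Lemma linZ a x : f (a *: x) = a *: f x.
Proof. by have := fL a x 0; rewrite lin0 !addr0. Qed.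

Lemma linB x y : f (x - y) = f x - f y.
Proof. by rewrite -scaleN1r linD linZ scaleN1r. Qed.

Lemma lin_sum I (r : seq I) (P : pred I) G :
  f (\sum_(i <- r | P i) G i) = \sum_(i <- r | P i) f (G i).
Proof. by elim/big_rec2: _ => [|i y1 y2 _ <-]; [exact: lin0|exact: linD]. Qed.
End Lin.

Section LinF.
Variables (U : lmodType F) (f : U -> F).
Hypothesis fL : linF f.

Lemma linF0 : f 0 = 0. Proof. exact: (lin0 (fL : lin (f : U -> F^o))). Qed.
Lemma linFD x y : f (x + y) = f x + f y.
Proof. exact: (linD (fL : lin (f : U -> F^o))). Qed.
Lemma linFB x y : f (x - y) = f x - f y.
Proof. exact: (linB (fL : lin (f : U -> F^o))). Qed.
Lemma linFZ a x : f (a *: x) = a * f x.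
Proof. exact: (linZ (fL : lin (f : U -> F^o))). Qed.
Lemma linF_sum I (r : seq I) (P : pred I) G :
  f (\sum_(i <- r | P i) G i) = \sum_(i <- r | P i) f (G i).
Proof. exact: (lin_sum (fL : lin (f : U -> F^o))). Qed.
End LinF.

Definition subspace (V : lmodType F) (D : V -> Prop) : Prop :=
  D 0 /\ forall (a : F) x y, D x -> D y -> D (a *: x + y).

Section Subspace.
Variable V : lmodType F.
Implicit Types D E : V -> Prop.

Lemma subspaceZ D a x : subspace D -> D x -> D (a *: x).
Proof. by move=> [D0 DL] Dx; rewrite -[_ *: _]addr0; apply: DL. Qed.

Lemma subspaceD D x y : subspace D -> D x -> D y -> D (x + y).
Proof. by move=> [D0 DL] Dx Dy; rewrite -[x]scale1r; apply: DL. Qed.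

Lemma subspaceB D x y : subspace D -> D x -> D y -> D (x - y).
Proof. by move=> [D0 DL] Dx Dy; rewrite addrC -scaleN1r; apply: DL. Qed.

Lemma subspace_sum D (I : eqType) (r : seq I) (G : I -> V) :
  subspace D -> (forall i, i \in r -> D (G i)) -> D (\sum_(i <- r) G i).
Proof.
move=> sD DG; rewrite big_seq; elim/big_rec: _ => [|i x ir Dx]; first exact: sD.1.
by apply: subspaceD => //; apply: DG.
Qed.

Definition addsp D E : V -> Prop := fun x => exists y z, [/\ D y, E z & x = y + z].
Definition capsp D E : V -> Prop := fun x => D x /\ E x.
Definition line (v : V) : V -> Prop := fun x => exists a : F, x = a *: v.

Lemma subspace_add D E : subspace D -> subspace E -> subspace (addsp D E).
Proof.
move=> sD sE; split; first by exists 0, 0; rewrite addr0; split=> //; [exact: sD.1|exact: sE.1].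
move=> a _ _ [y [z [Dy Ez ->]]] [y' [z' [Dy' Ez' ->]]].
exists (a *: y + y'), (a *: z + z'); split; [exact: sD.2|exact: sE.2|].
by rewrite scalerDr addrACA.
Qed.

Lemma subspace_cap D E : subspace D -> subspace E -> subspace (capsp D E).
Proof.
move=> sD sE; split; first by split; [exact: sD.1|exact: sE.1].
by move=> a x y [Dx Ex] [Dy Ey]; split; [exact: sD.2|exact: sE.2].
Qed.

Lemma subspace_line v : subspace (line v).
Proof.
split; first by exists 0; rewrite scale0r.
by move=> a _ _ [b ->] [c ->]; exists (a * b + c); rewrite scalerDl scalerA.
Qed.

Lemma subspace_ker (W : lmodType F) (f : V -> W) : lin f -> subspace (fun x => f x = 0).
Proof. by move=> fL; split=> [|a x y fx fy]; rewrite ?(lin0 fL) // fL fx fy scaler0 addr0. Qed.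

Lemma addspl D E x : E 0 -> D x -> addsp D E x.
Proof. by move=> E0 Dx; exists x, 0; rewrite addr0. Qed.
Lemma addspr D E x : D 0 -> E x -> addsp D E x.
Proof. by move=> D0 Ex; exists 0, x; rewrite add0r. Qed.

Definition stable (Om : (V -> V) -> Prop) D : Prop := forall f, Om f -> forall x, D x -> D (f x).

(* The avoided set [W] need not be a subspace: it is a complement in one use, a single vector in others. *)
Lemma maximal_stable_avoiding (Om : (V -> V) -> Prop) D (W : V -> Prop) :
  subspace D -> stable Om D -> (forall x, D x -> W x -> x = 0) ->
  exists M, [/\ subspace M /\ stable Om M, (forall x, D x -> M x), (forall x, M x -> W x -> x = 0)
    & forall N, subspace N -> stable Om N -> (forall x, M x -> N x) ->
        (forall x, N x -> W x -> x = 0) -> forall x, N x -> M x].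
Proof.
move=> sD oD DW.
pose P (K : V -> Prop) := [/\ subspace K, stable Om K & forall x, K x -> W x -> x = 0].
(* Joining [D] to [X] lets the empty chain have an upper bound too. *)
pose Q (X : classical_sets.set V) := P (fun x => D x \/ X x).
have [|A [QA Amax]] := @classical_sets.Zorn_bigcup V Q.
  move=> Fam FQ Ftot.
  have [[X0 FX0]|noF] := boolp.EM (exists X, Fam X); last first.
    have E x : (D x \/ classical_sets.bigcup Fam id x) -> D x.
      by case=> // -[X FX]; case: noF; exists X.
    split; first by split=> [|a x y /E Dx /E Dy]; left; [exact: sD.1|exact: sD.2].
    - by move=> f Of x /E Dx; left; apply: oD.
    - by move=> x /E; apply: DW.
  have up x : (D x \/ classical_sets.bigcup Fam id x) -> exists2 X, Fam X & D x \/ X x.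
    by case=> [Dx|[X FX Xx]]; [exists X0 => //; left|exists X => //; right].
  have down X x : Fam X -> D x \/ X x -> D x \/ classical_sets.bigcup Fam id x.
    by move=> FX [|Xx]; [left|right; exists X].
  split; first split; first by left; exact: sD.1.
  - move=> a x y /up[X FX Hx] /up[Y FY Hy].
    have [XY|YX] := Ftot _ _ FX FY.
      apply: (down Y) => //; have [[_ +] _ _] := FQ _ FY; apply=> //.
      by case: Hx => [|/XY]; [left|right].
    apply: (down X) => //; have [[_ +] _ _] := FQ _ FX; apply=> //.
    by case: Hy => [|/YX]; [left|right].
  - move=> f Of x /up[X FX Hx]; apply: (down X) => //.
    by have [_ + _] := FQ _ FX; apply.
  - by move=> x /up[X FX Hx]; have [_ _] := FQ _ FX; apply.
exists (fun x => D x \/ A x); case: QA => sA oA AW; split=> //; first by move=> x; left.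
move=> N sN oN MN NW x Nx; apply: boolp.contrapT => nMx.
apply: (Amax N); first by split=> [y Ay|NA]; [apply: MN; right|apply: nMx; right; apply: NA].
have E y : (D y \/ N y) -> N y by case=> // Dy; apply: MN; left.
split; first by split=> [|a y z /E Ny /E Nz]; right; [exact: sN.1|exact: sN.2].
- by move=> f Of y /E Ny; right; apply: oN.
- by move=> y /E; apply: NW.
Qed.

(** By Zorn, [D] lies in a subspace [M] maximal among those meeting [E] only in 0. Then [M + E] is
    everything: if [x] were outside, adjoining its line to [M] would still avoid [E]. The map [p] is
    the projection onto [E] along [M]. *)
Lemma projection_killing D E :
  subspace D -> subspace E -> (forall x, D x -> E x -> x = 0) ->
  exists p : V -> V, [/\ lin p, forall x, E (p x), forall x, E x -> p x = x & forall x, D x -> p x = 0].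
Proof.
move=> sD sE DE.
have [|M [[sM _] DM ME Mmax]] := maximal_stable_avoiding (Om := fun=> False) sD _ DE; first by [].
have full x : addsp M E x.
  apply: boolp.contrapT => nx.
  suff: M x by move=> Mx; apply: nx; apply: addspl => //; apply: sE.1.
  have sN := subspace_add sM (subspace_line x).
  apply: (Mmax _ sN) => //; first by move=> y My; apply: addspl => //; apply: (subspace_line _).1.
    move=> _ [y [_ [My [a ->] ->]]]; have [->|a0 Ez] := eqVneq a 0.
      by rewrite scale0r addr0; apply: ME.
    case: nx; exists (- (a^-1 *: y)), (a^-1 *: (y + a *: x)); split.
    - by rewrite -scaleN1r; do 2 apply: subspaceZ => //.
    - exact: subspaceZ.
    - by rewrite scalerDr addKr scalerA mulVf // scale1r.
  by exists 0, x; split; [exact: sM.1|exists 1; rewrite scale1r|rewrite add0r].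
have /boolp.choice[p Hp] : forall x, exists y, E y /\ M (x - y).
  by move=> x; have [y [z [My Ez ->]]] := full x; exists z; rewrite addrK.
have uniq x y : E y -> M (x - y) -> p x = y.
  move=> Ey Mxy; have [Epx Mpx] := Hp x; apply/eqP; rewrite -subr_eq0; apply/eqP.
  apply: ME; last exact: subspaceB.
  have -> : p x - y = (x - y) - (x - p x) by rewrite opprB [RHS]addrC subrKA.
  exact: subspaceB.
exists p; split.
- move=> a x y; apply: uniq; first by apply: sE.2; [case: (Hp x)|case: (Hp y)].
  rewrite opprD addrACA -scalerBr; apply: sM.2; [by case: (Hp x)|by case: (Hp y)].
- by move=> x; case: (Hp x).
- by move=> x Ex; apply: uniq => //; rewrite subrr; apply: sM.1.
- by move=> x Dx; apply: uniq; [apply: sE.1|rewrite subr0; apply: DM].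
Qed.

(** [f] is the coefficient of [x] in a projection onto the line of [x] that kills [D]. *)
Lemma functional_separation D x :
  subspace D -> ~ D x -> exists f : V -> F, [/\ linF f, f x = 1 & forall y, D y -> f y = 0].
Proof.
move=> sD nDx.
have [|p [pL pE pid pD]] := projection_killing sD (subspace_line x).
  move=> y Dy [a ya]; have [a0|a0] := eqVneq a 0; first by rewrite ya a0 scale0r.
  by case: nDx; rewrite -[x]scale1r -(mulVf a0) -scalerA -ya; apply: subspaceZ.
have x0 : x != 0 by apply/eqP => x0; apply: nDx; rewrite x0; apply: sD.1.
have /boolp.choice[f Hf] := pE.
have inj a b : a *: x = b *: x -> a = b.
  move/eqP; rewrite -subr_eq0 -scalerBl scaler_eq0 (negPf x0) orbF subr_eq0.
  by move/eqP.
exists f; split=> [a y z||y Dy]; apply: inj; rewrite -?Hf.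
- by rewrite pL !Hf scalerDl scalerA.
- by rewrite pid ?scale1r //; exists 1; rewrite scale1r.
- by rewrite pD // scale0r.
Qed.

Lemma functionals_separate x y : (forall f : V -> F, linF f -> f x = f y) -> x = y.
Proof.
move=> fxy; apply: boolp.contrapT => xy.
have [||f [fL f1 _]] := @functional_separation (line 0) (x - y); first exact: subspace_line.
  by move=> [a]; rewrite scaler0 => /eqP; rewrite subr_eq0 => /eqP.
by move: f1; rewrite (linFB fL) fxy // subrr => /eqP; rewrite eq_sym oner_eq0.
Qed.

(** The functionals live on all of [V], so that they can act on a whole coalgebra, but they expand
    only the vectors of [D]. *)
Definition dual_basis (D : V -> Prop) n (v : 'I_n -> V) (phi : 'I_n -> V -> F) : Prop :=
  [/\ forall i, linF (phi i), forall i, D (v i), forall i j, phi i (v j) = (i == j)%:R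
    & forall x, D x -> x = \sum_i phi i x *: v i].

Lemma linF_comb_sub (f g : V -> F) (c : F) : linF f -> linF g -> linF (fun x => f x - c * g x).
Proof. by move=> fL gL a x y; rewrite fL gL mulrDr opprD addrACA mulrBr (mulrCA c). Qed.

(* Induction on the list: a functional which does not vanish on [D] splits off a vector,
   the others separate the points of its kernel in [D]. *)
Lemma dual_basis_of_separating (psi : seq (V -> F)) D :
  subspace D -> foldr (fun f P => linF f /\ P) True psi ->
  (forall x, D x -> foldr (fun (f : V -> F) P => f x = 0 /\ P) True psi -> x = 0) ->
  exists n (v : 'I_n -> V) phi, dual_basis D v phi.
Proof.
elim: psi D => [|f psi IH] D sD /= psiL sep.
  exists 0%N, (fun=> 0), (fun=> fun=> 0); split=> [[]|[]|[]|x Dx] //.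
  by rewrite big_ord0; apply: sep.
case: psiL => fL psiL.
have [fD|] := boolp.EM (forall x, D x -> f x = 0).
  by apply: IH => // x Dx sx; apply: sep => //; split=> //; apply: fD.
move=> /boolp.existsNP[y0 /boolp.not_implyP[Dy0 /eqP fy0]].
pose y := (f y0)^-1 *: y0.
have fy : f y = 1 by rewrite /y (linFZ fL) mulVf.
have Dy : D y by apply: subspaceZ.
have sK : subspace (fun x => D x /\ f x = 0).
  by apply: subspace_cap => //; apply: (subspace_ker (W := F^o)).
have [|n [v [phi [phiL Dv dual spanned]]]] := IH _ sK psiL.
  by move=> x [Dx fx] sx; apply: sep.
(* Index 0 carries [y] and [f]; each older functional is corrected by a multiple of [f] so as to
   vanish at [y]. *)
exists n.+1, (fun i => oapp v y (unlift ord0 i)),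
  (fun i => oapp (fun j x => phi j x - phi j y * f x) f (unlift ord0 i)); split.
- by move=> i; case: unliftP => [j|] _ //=; apply: linF_comb_sub.
- by move=> i; case: unliftP => [j|] _ //=; case: (Dv j).
- move=> i j; case: unliftP => [i'|] -> /=; case: unliftP => [j'|] -> /=.
  + by rewrite (Dv j').2 mulr0 subr0 dual (inj_eq lift_inj).
  + by rewrite fy mulr1 subrr.
  + by rewrite (Dv j').2.
  + by rewrite fy.
- move=> x Dx; rewrite big_ord_recl unlift_none /=.
  under eq_bigr => i _ do rewrite liftK /=.
  have /spanned E : D (x - f x *: y) /\ f (x - f x *: y) = 0.
    by rewrite (linFB fL) (linFZ fL) fy mulr1 subrr; split=> //; apply: subspaceB => //; apply: subspaceZ.
  rewrite -[LHS](subrK (f x *: y)) addrC; congr (_ + _); rewrite E.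
  by apply: eq_bigr => i _; rewrite (linFB (phiL i)) (linFZ (phiL i)) mulrC.
Qed.

Fixpoint spanned (s : seq V) : V -> Prop :=
  if s is v :: s' then addsp (spanned s') (line v) else fun x => x = 0.

Lemma subspace_spanned s : subspace (spanned s).
Proof.
elim: s => [|v s IH] /=; first by split=> // a x y -> ->; rewrite scaler0 addr0.
by apply: subspace_add => //; apply: subspace_line.
Qed.

Lemma mem_spanned s x : x \in s -> spanned s x.
Proof.
elim: s => //= v s IH; rewrite inE => /orP[/eqP->|/IH xs].
  by apply: addspr; [exact: (subspace_spanned s).1|exists 1; rewrite scale1r].
by apply: addspl => //; exact: (subspace_line _).1.
Qed.

Lemma spanned_cat s t x y : spanned s x -> spanned t y -> spanned (s ++ t) (x + y).
Proof.
elim: s x => [|v s IH] x /=; first by move=> ->; rewrite add0r.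
move=> [x' [_ [sx' [a ->] ->]]] ty; exists (x' + y), (a *: v); split=> //; first exact: IH.
  by exists a.
by rewrite addrAC.
Qed.

(** Induction on the list: when the new vector leaves the span of the others, a functional detecting
    its coefficient is added. *)
Lemma separating_functionals_spanned s : exists psi : seq (V -> F),
  foldr (fun f P => linF f /\ P) True psi /\
  forall x, spanned s x -> foldr (fun (f : V -> F) P => f x = 0 /\ P) True psi -> x = 0.
Proof.
elim: s => [|v s [psi [psiL sep]]]; first by exists [::].
have [vs|nvs] := boolp.EM (spanned s v).
  exists psi; split=> // _ [y [_ [sy [a ->] ->]]]; apply: sep.
  by apply: subspaceD => //; [|apply: subspaceZ => //]; apply: subspace_spanned.
have [f [fL fv fs]] := functional_separation (subspace_spanned s) nvs.
exists (f :: psi); split=> // _ [y [_ [sy [a ->] ->]]] [].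
rewrite (linFD fL) (linFZ fL) fv fs // add0r mulr1 => ->; rewrite scale0r addr0.
exact: sep.
Qed.

Lemma dual_basis_finite D s : subspace D -> (forall x, D x -> spanned s x) ->
  exists n (v : 'I_n -> V) phi, dual_basis D v phi.
Proof.
move=> sD Ds; have [psi [psiL sep]] := separating_functionals_spanned s.
by apply: (dual_basis_of_separating sD psiL) => x /Ds; apply: sep.
Qed.

End Subspace.
End LinearAlgebra.

(** * Sweedler notation *)

Section Multilinear.
Variable F : fieldType.
Implicit Types U V W : lmodType F.

Definition lin2 U V W (phi : U -> V -> W) : Prop :=
  (forall v, lin (fun u => phi u v)) /\ (forall u, lin (phi u)).
Definition lin3 U V W (X : lmodType F) (phi : U -> V -> W -> X) : Prop :=
  [/\ forall v w, lin (fun u => phi u v w), forall u w, lin (fun v => phi u v w)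
    & forall u v, lin (phi u v)].

Lemma lin_id U : lin (fun x : U => x). Proof. by []. Qed.
Lemma lin_add U V (f g : U -> V) : lin f -> lin g -> lin (fun x => f x + g x).
Proof. by move=> fL gL a x y; rewrite fL gL scalerDr addrACA. Qed.
Lemma lin_scale U V c (f : U -> V) : lin f -> lin (fun x => c *: f x).
Proof. by move=> fL a x y; rewrite fL scalerDr !scalerA mulrC. Qed.
Lemma lin_scalel U V (f : U -> F) (v : V) : linF f -> lin (fun x => f x *: v).
Proof. by move=> fL a x y; rewrite fL scalerDl scalerA. Qed.
Lemma lin_mull U (A : algType F) (f : U -> A) c : lin f -> lin (fun x => f x * c).
Proof. by move=> fL a x y; rewrite fL mulrDl scalerAl. Qed.
Lemma lin_mulr U (A : algType F) (f : U -> A) c : lin f -> lin (fun x => c * f x).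
Proof. by move=> fL a x y; rewrite fL mulrDr scalerAr. Qed.
Lemma lin_comp U V W (f : V -> W) (g : U -> V) : lin f -> lin g -> lin (fun x => f (g x)).
Proof. by move=> fL gL a x y; rewrite gL fL. Qed.
Lemma lin_bigop U V I (r : seq I) (G : U -> I -> V) :
  (forall i, lin (fun x => G x i)) -> lin (fun x => \sum_(i <- r) G x i).
Proof.
move=> GL a x y; rewrite scaler_sumr -big_split /=.
by apply: eq_bigr => i _; rewrite GL.
Qed.
Lemma linF_comp U V (f : V -> F) (g : U -> V) : linF f -> lin g -> linF (fun x => f (g x)).
Proof. by move=> fL gL a x y; rewrite gL fL. Qed.
Lemma linF_mull U (f : U -> F) c : linF f -> linF (fun x => f x * c).
Proof. by move=> fL a x y; rewrite fL mulrDl mulrA. Qed.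
Lemma linF_mulr U (f : U -> F) c : linF f -> linF (fun x => c * f x).
Proof. by move=> fL a x y; rewrite fL mulrDr mulrCA. Qed.
End Multilinear.

Section Sweedler.
Variables (F : fieldType) (H : hopf F).
Implicit Types (W : lmodType F) (x y : H).

Definition sw W (phi : H -> H -> W) x : W := \sum_(p <- hdelta x) phi p.1 p.2.

Lemma eq_sw W (phi psi : H -> H -> W) x : (forall u v, phi u v = psi u v) -> sw phi x = sw psi x.
Proof. by move=> E; apply: eq_bigr => p _. Qed.

Lemma sw_map W W' (f : W -> W') (phi : H -> H -> W) x :
  lin f -> f (sw phi x) = sw (fun u v => f (phi u v)) x.
Proof. by move=> fL; rewrite /sw (lin_sum fL). Qed.

(** The axioms test tensors on scalar forms only. Composing with all functionals, which separate
    points, extends them to values in [W], here and in the next lemmas. *)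
Lemma sw_lin W (phi : H -> H -> W) : lin2 phi -> lin (sw phi).
Proof.
move=> [pl pr] a x y; apply: functionals_separate => f fL.
rewrite (linFD fL) (linFZ fL) !(linF_sum fL).
apply: (hd_lin (hax H) (phi := fun u v => f (phi u v))); split=> [v|u];
  apply: linF_comp fL _; [exact: pl|exact: pr].
Qed.

Lemma sw_coassoc W (phi : H -> H -> H -> W) x : lin3 phi ->
  sw (fun u v => sw (fun a b => phi a b v) u) x = sw (fun u v => sw (fun a b => phi u a b) v) x.
Proof.
move=> [p1 p2 p3]; apply: functionals_separate => f fL; rewrite /sw !(linF_sum fL).
under eq_bigr => i _ do rewrite (linF_sum fL); under [RHS]eq_bigr => i _ do rewrite (linF_sum fL).
apply: (hd_coassoc (hax H) (phi := fun u v w => f (phi u v w))).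
by split; [|split] => *; apply: linF_comp fL _; [exact: p1|exact: p2|exact: p3].
Qed.

Lemma sw_mul W (phi : H -> H -> W) x y : lin2 phi ->
  sw phi (x * y) = sw (fun a b => sw (fun c d => phi (a * c) (b * d)) y) x.
Proof.
move=> [p1 p2]; apply: functionals_separate => f fL; rewrite /sw !(linF_sum fL).
under [RHS]eq_bigr => i _ do rewrite (linF_sum fL).
apply: (hd_mul (hax H) (phi := fun u v => f (phi u v))).
by split=> *; apply: linF_comp fL _; [exact: p1|exact: p2].
Qed.

Lemma sw_one W (phi : H -> H -> W) : lin2 phi -> sw phi 1 = phi 1 1.
Proof.
move=> [p1 p2]; apply: functionals_separate => f fL; rewrite /sw !(linF_sum fL).
apply: (hd_one (hax H) (phi := fun u v => f (phi u v))).
by split=> *; apply: linF_comp fL _; [exact: p1|exact: p2].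
Qed.

Lemma sw_counitl W (g : H -> W) x : lin g -> sw (fun u v => heps u *: g v) x = g x.
Proof.
move=> gL; rewrite -[in RHS](hcounit_l (hax H) x) (lin_sum gL).
by apply: eq_bigr => p _; rewrite (linZ gL).
Qed.

Lemma sw_counitr W (g : H -> W) x : lin g -> sw (fun u v => heps v *: g u) x = g x.
Proof.
move=> gL; rewrite -[in RHS](hcounit_r (hax H) x) (lin_sum gL).
by apply: eq_bigr => p _; rewrite (linZ gL).
Qed.

Lemma sw_antil W (g : H -> W) x : lin g -> sw (fun u v => g (hanti u * v)) x = heps x *: g 1.
Proof. by move=> gL; rewrite -(linZ gL) -(hS_l (hax H)) (lin_sum gL). Qed.

Lemma sw_antir W (g : H -> W) x : lin g -> sw (fun u v => g (u * hanti v)) x = heps x *: g 1.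
Proof. by move=> gL; rewrite -(linZ gL) -(hS_r (hax H)) (lin_sum gL). Qed.

End Sweedler.

Lemma sw_exchange (F : fieldType) (H K : hopf F) (W : lmodType F)
    (phi : H -> H -> K -> K -> W) x y :
  sw (fun u v => sw (fun a b => phi u v a b) y) x = sw (fun a b => sw (fun u v => phi u v a b) x) y.
Proof. exact: exchange_big. Qed.

Notation "\D_ ( u , v <- x ) E" := (sw (fun u v => E) x)
  (at level 41, E at level 41, u, v, x at level 50, format "\D_ ( u ,  v  <-  x )  E").

Ltac lin_leaf :=
  first
  [ assumption
  | exact: (hS_lin (hax _))
  | exact: (he_lin (hax _))
  | match goal with
    | h : lin2 ?p |- lin (?p _) => exact: (h.2 _)
    | h : lin2 ?p |- lin (fun z__ => ?p z__ _) => exact: (h.1 _)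
    | h : bilin ?p |- linF (?p _) => exact: (h.2 _)
    | h : bilin ?p |- linF (fun z__ => ?p z__ _) => exact: (h.1 _)
    | h : trilin ?p |- linF (?p _ _) => exact: (h.2.2 _ _)
    | h : trilin ?p |- linF (fun z__ => ?p _ z__ _) => exact: (h.2.1 _ _)
    | h : trilin ?p |- linF (fun z__ => ?p z__ _ _) => exact: (h.1 _ _)
    end ].

(* A pattern binder named like a variable of the context does not match, hence [z__]. *)
Ltac lin_auto :=
  cbn beta;
  lazymatch goal with
  | |- lin2 _ => split; intro; lin_auto
  | |- lin3 _ => split; intros ? ?; lin_auto
  | |- bilin _ => split; intro; lin_auto
  | |- trilin _ => split; [|split]; intros ? ?; lin_auto
  | |- @lin ?F ?U _ ?f => first [lin_auto_lin | change (@linF F U f); lin_auto_linF]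
  | |- linF _ => lin_auto_linF
  end
with lin_auto_lin :=
  match goal with
  | |- lin (fun z__ => z__) => exact: lin_id
  | |- lin _ => lin_leaf
  | |- lin (@GRing.mul _ ?c) => exact: (@lin_mulr _ _ _ (fun z => z) c (@lin_id _ _))
  | |- lin (@GRing.scale _ _ ?c) => exact: (@lin_scale _ _ _ c (fun z => z) (@lin_id _ _))
  | |- lin (fun z__ => @?a z__ + @?b z__) => apply: (@lin_add _ _ _ a b); lin_auto
  | |- @lin ?F ?U ?V (fun z__ => ?c *: @?b z__) => apply: (@lin_scale F U V c b); lin_auto
  | |- @lin ?F ?U ?V (fun z__ => @?b z__ *: ?c) => apply: (@lin_scalel F U V b c); lin_auto
  | |- lin (fun z__ => ?c * @?b z__) => apply: (@lin_mulr _ _ _ b c); lin_auto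
  | |- lin (fun z__ => @?b z__ * ?c) => apply: (@lin_mull _ _ _ b c); lin_auto
  | |- lin (sw _) => apply: sw_lin; lin_auto
  | |- lin (fun z__ => sw _ (@?g z__)) => apply: (@lin_comp _ _ _ _ (sw _) g); [apply: sw_lin; lin_auto | lin_auto]
  | |- lin (fun z__ => sw _ _) => apply: lin_bigop; intro; lin_auto
  | |- lin (fun z__ => ?f (@?g z__)) => apply: (@lin_comp _ _ _ _ f g); lin_auto
  | |- lin (fun z__ => ?f (@?g z__) ?c) => apply: (@lin_comp _ _ _ _ (fun y => f y c) g); lin_auto
  end
with lin_auto_linF :=
  match goal with
  | |- linF _ => lin_leaf
  | |- linF (fun z__ => ?c * @?b z__) => apply: (@linF_mulr _ _ b c); lin_auto
  | |- linF (fun z__ => @?b z__ * ?c) => apply: (@linF_mull _ _ b c); lin_auto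
  | |- linF (sw _) => apply: (@sw_lin _ _ _^o); lin_auto
  | |- linF (fun z__ => ?f (@?g z__)) => apply: (@linF_comp _ _ _ f g); lin_auto
  | |- linF (fun z__ => ?f (@?g z__) ?c) => apply: (@linF_comp _ _ _ (fun y => f y c) g); lin_auto
  | |- linF (fun z__ => ?f (@?g z__) ?c ?d) => apply: (@linF_comp _ _ _ (fun y => f y c d) g); lin_auto
  end.

(** * The antipode reverses the coproduct *)

Section Antipode.
Variables (F : fieldType) (H : hopf F).
Implicit Types (W : lmodType F) (x y : H).

(** Inserting [x_3 S(x_4)] in the second slot produces the coproduct of [S(x_1) x_2], which
    collapses by the antipode axiom. *)
Lemma sw_anti_cancel W (phi : H -> H -> W) x : lin2 phi ->
  \D_(a, b <- x) \D_(c, d <- hanti a) phi (c * b) d = phi 1 (hanti x).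
Proof.
move=> phiL.
transitivity (\D_(a, b <- x) \D_(b1, b2 <- b) \D_(e, f <- b2)
   \D_(c, d <- hanti a) phi (c * b1) (d * (e * hanti f))).
  apply: eq_sw => a b.
  rewrite -[LHS](@sw_counitr _ _ _ (fun b => \D_(c, d <- hanti a) phi (c * b) d)); last by lin_auto.
  apply: eq_sw => b1 b2.
  rewrite (@sw_antir _ _ _ (fun z => \D_(c, d <- hanti a) phi (c * b1) (d * z))); last by lin_auto.
  by under [in RHS]eq_sw => u v do rewrite mulr1.
transitivity (\D_(a, b <- x) \D_(b', f <- b) \D_(b1, e <- b')
   \D_(c, d <- hanti a) phi (c * b1) (d * (e * hanti f))).
  apply: eq_sw => a b.
  by rewrite (@sw_coassoc _ _ _ (fun b1 e f => \D_(c, d <- hanti a) phi (c * b1) (d * (e * hanti f)))) //; lin_auto.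
rewrite -(@sw_coassoc _ _ _ (fun a b' f => \D_(b1, e <- b')
   \D_(c, d <- hanti a) phi (c * b1) (d * (e * hanti f)))); last by lin_auto.
rewrite -(@sw_counitl _ _ _ (fun f => phi 1 (hanti f))); last by lin_auto.
apply: eq_sw => x' f.
have -> : heps x' *: phi 1 (hanti f) = heps x' *: \D_(u, v <- 1) phi u (v * hanti f).
  by rewrite (sw_one (phi := fun u v => phi u (v * hanti f))) ?mul1r //; lin_auto.
rewrite -(@sw_antil _ _ _ (sw (fun u v => phi u (v * hanti f)))); last by lin_auto.
apply: eq_sw => a b'; rewrite sw_mul; last by lin_auto.
rewrite sw_exchange; apply: eq_sw => u v; apply: eq_sw => c d.
by rewrite mulrA.
Qed.

(** Inserting [x_2 S(x_3)] in the first slot makes [sw_anti_cancel] applicable. *)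
Lemma sw_anti W (phi : H -> H -> W) x : lin2 phi ->
  sw phi (hanti x) = \D_(a, b <- x) phi (hanti b) (hanti a).
Proof.
move=> phiL.
transitivity (\D_(u, e <- x) \D_(a, b <- u) \D_(c, d <- hanti a) phi (c * (b * hanti e)) d).
  rewrite (@sw_coassoc _ _ _ (fun a b e => \D_(c, d <- hanti a) phi (c * (b * hanti e)) d)); last by lin_auto.
  rewrite -[LHS](@sw_counitr _ _ _ (fun a => sw phi (hanti a))); last by lin_auto.
  apply: eq_sw => a b.
  rewrite (@sw_antir _ _ _ (fun z => \D_(c, d <- hanti a) phi (c * z) d)); last by lin_auto.
  by under [in RHS]eq_sw => u v do rewrite mulr1.
apply: eq_sw => u e.
under eq_sw => a b do under eq_sw => c d do rewrite mulrA.
rewrite (sw_anti_cancel (phi := fun c d => phi (c * hanti e) d)) ?mul1r //; lin_auto.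
Qed.

Lemma anti1 : hanti (1 : H) = 1.
Proof.
have := sw_antil 1 (@lin_id _ H); rewrite (he_one (hax H)) scale1r.
by rewrite (sw_one (phi := fun u v => hanti u * v)) ?mulr1 //; lin_auto.
Qed.
End Antipode.

(** * Hits, subcoalgebras and integrals *)

Section Hits.
Variables (F : fieldType) (H : hopf F).
Implicit Types (W : lmodType F) (x y : H) (f g I : H -> F).

(** With [lhit], the two actions of the dual algebra on [H]. A linear [I] is a left integral when
    [rhit I x = I x *: 1] for all [x]. *)
Definition rhit f x : H := \D_(u, v <- x) f v *: u.
Definition lhit f x : H := \D_(u, v <- x) f u *: v.

Lemma rhit_lin f : linF f -> lin (rhit f).
Proof. by move=> fL; rewrite /rhit; lin_auto. Qed.

Lemma lhit_lin f : linF f -> lin (lhit f).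
Proof. by move=> fL; rewrite /lhit; lin_auto. Qed.

(** Both sides are the sum of [g(x_1) f(x_2)]. *)
Lemma hit_adj f g x : linF f -> linF g -> g (rhit f x) = f (lhit g x).
Proof.
move=> fL gL; rewrite /rhit /lhit /sw (linF_sum gL) (linF_sum fL).
by apply: eq_bigr => p _; rewrite (linFZ gL) (linFZ fL) mulrC.
Qed.

Lemma eps_lhit f x : linF f -> heps (lhit f x) = f x.
Proof.
move=> fL; have eL := he_lin (hax H); rewrite -(hit_adj _ eL fL).
by rewrite /rhit (sw_counitr (g := fun x => x)).
Qed.

Lemma eps_rhit f x : linF f -> heps (rhit f x) = f x.
Proof.
move=> fL; have eL := he_lin (hax H); rewrite (hit_adj _ fL eL).
by rewrite /lhit (sw_counitl (g := fun x => x)).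
Qed.

Lemma rhit1 f : linF f -> rhit f 1 = f 1 *: 1.
Proof. by move=> fL; rewrite /rhit (sw_one (phi := fun u v => f v *: u)) //; lin_auto. Qed.

Lemma lhit1 f : linF f -> lhit f 1 = f 1 *: 1.
Proof. by move=> fL; rewrite /lhit (sw_one (phi := fun u v => f u *: v)) //; lin_auto. Qed.

Lemma hitC f g x : linF f -> linF g -> lhit g (rhit f x) = rhit f (lhit g x).
Proof.
move=> fL gL.
rewrite [in LHS]/rhit (sw_map _ _ (lhit_lin gL)) [in RHS]/lhit (sw_map _ _ (rhit_lin fL)).
transitivity (\D_(u, v <- x) \D_(a, b <- u) (f v * g a) *: b).
  apply: eq_sw => u v; rewrite (linZ (lhit_lin gL)) (sw_map _ _ (lin_scale (f v) (@lin_id _ _))).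
  by apply: eq_sw => a b; rewrite scalerA.
rewrite (@sw_coassoc _ _ _ (fun a b v => (f v * g a) *: b)); last by lin_auto.
apply: eq_sw => u v; rewrite (linZ (rhit_lin fL)) (sw_map _ _ (lin_scale (g u) (@lin_id _ _))).
by apply: eq_sw => a b; rewrite scalerA mulrC.
Qed.

Lemma subspace_rhits x : subspace (fun y => exists2 f, linF f & y = rhit f x).
Proof.
split; first by exists (fun=> 0); [move=> a y z; rewrite mulr0 addr0|
  rewrite /rhit /sw big1 // => p _; rewrite scale0r].
move=> a _ _ [f fL ->] [g gL ->]; exists (fun y => a * f y + g y).
  by move=> b y z; rewrite fL gL !mulrDr addrACA mulrCA.
rewrite /rhit /sw scaler_sumr -big_split /=.
by apply: eq_bigr => p _; rewrite scalerDl scalerA.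
Qed.

Lemma rhits_spanned f x : spanned (unzip1 (hdelta x)) (rhit f x).
Proof.
have sS := subspace_spanned (unzip1 (hdelta x)).
apply: subspace_sum => // p px; apply: subspaceZ => //.
by apply/mem_spanned/map_f.
Qed.

(* When [D] contains the left leg of the coproduct of [x], expanding that leg in a basis
   of [D] turns the right leg into left hits of [x]. *)
Lemma comul_expand (D : H -> Prop) n (v : 'I_n -> H) (phi : 'I_n -> H -> F) x W (psi : H -> H -> W) :
  dual_basis D v phi -> (forall f, linF f -> D (rhit f x)) -> lin2 psi ->
  sw psi x = \sum_i psi (v i) (lhit (phi i) x).
Proof.
move=> [phiL Dv _ span1] Dx psiL.
have s2 := subspace_spanned (unzip2 (hdelta x)).
(* Expanding the right leg first turns the left legs into right hits of [x], which lie in [D] and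
   can be expanded in turn. *)
have [//|m [u [th [thL Du _ span2]]]] := dual_basis_finite (s := unzip2 (hdelta x)) s2.
have lhit2 i : spanned (unzip2 (hdelta x)) (lhit (phi i) x).
  by apply: subspace_sum => // p px; apply: subspaceZ => //; apply/mem_spanned/map_f.
transitivity (\sum_j psi (rhit (th j) x) (u j)).
  rewrite /sw big_seq.
  under eq_bigr => p px.
    rewrite (span2 p.2) ?(lin_sum (psiL.2 _)); last by apply/mem_spanned/map_f.
    over.
  rewrite -big_seq exchange_big /=; apply: eq_bigr => j _.
  rewrite [in RHS]/rhit (sw_map _ _ (psiL.1 _)); apply: eq_bigr => p _.
  by rewrite (linZ (psiL.2 _)) (linZ (psiL.1 _)).
transitivity (\sum_j \sum_i (phi i (rhit (th j) x) *: psi (v i) (u j))).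
  apply: eq_bigr => j _; rewrite {1}(span1 (rhit (th j) x)); last exact: Dx.
  by rewrite (lin_sum (psiL.1 _)); apply: eq_bigr => i _; rewrite (linZ (psiL.1 _)).
rewrite exchange_big /=; apply: eq_bigr => i _.
rewrite [in RHS](span2 (lhit (phi i) x)) // (lin_sum (psiL.2 _)).
by apply: eq_bigr => j _; rewrite hit_adj // (linZ (psiL.2 _)).
Qed.

(** The right hits of [x] lie in the span of its left legs, so they form a finite-dimensional space
    in which to expand. *)
Lemma comul_dual x : exists n (v : 'I_n -> H) (phi : 'I_n -> H -> F),
  [/\ forall i, linF (phi i), forall i, exists2 f, linF f & v i = rhit f x
    & forall W (psi : H -> H -> W), lin2 psi -> sw psi x = \sum_i psi (v i) (lhit (phi i) x)].
Proof.
have [_ [f fL ->]|n [v [phi B]]] := dual_basis_finite (s := unzip1 (hdelta x)) (subspace_rhits x).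
  exact: rhits_spanned.
exists n, v, phi; have [phiL Dv _ _] := B; split=> // W psi psiL.
by apply: (comul_expand B) => // f fL; exists f.
Qed.

(** Subcoalgebras without tensors: this form passes easily to sums, intersections and unions of
    chains. *)
Definition hitsub (D : H -> Prop) : Prop :=
  subspace D /\ forall f, linF f -> forall x, D x -> D (rhit f x) /\ D (lhit f x).

(** A tensor with both legs in [D] computes the hits inside [D]; conversely [comul_dual] writes the
    coproduct with right hits on the left and left hits on the right. *)
Lemma subcoalgP (D : H -> Prop) : subcoalg D <-> hitsub D.
Proof.
split=> [[D0 [DL Dt]]|[[D0 DL] Dh]].
  have sD : subspace D by [].
  split=> // f fL x /Dt[t [tD tE]].
  have E (g : H -> H -> H) : lin2 g -> sw g x = \sum_(p <- t) g p.1 p.2.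
    move=> gL; apply: functionals_separate => h hL; rewrite /sw !(linF_sum hL).
    by symmetry; apply: (tE (fun u v => h (g u v))); lin_auto.
  split; [rewrite /rhit (E (fun u v => f v *: u))|rewrite /lhit (E (fun u v => f u *: v))];
    try by lin_auto.
    by apply: subspace_sum => // p /tD[D1 D2]; apply: subspaceZ.
  by apply: subspace_sum => // p /tD[D1 D2]; apply: subspaceZ.
split=> //; split=> // x Dx.
have [n [v [phi [phiL Dv E]]]] := comul_dual x.
exists [seq (v i, lhit (phi i) x) | i <- index_enum 'I_n]; split.
  move=> _ /mapP[i _ ->]; split=> /=; last by apply: (Dh _ (phiL i) _ Dx).2.
  by have [f fL ->] := Dv i; apply: (Dh _ fL _ Dx).1.
move=> psi psiL; rewrite /tev big_map.
by rewrite -(E F^o psi).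
Qed.

Lemma hitsub_add D E : hitsub D -> hitsub E -> hitsub (addsp D E).
Proof.
move=> [sD hD] [sE hE]; split=> [|f fL _ [y [z [Dy Ez ->]]]]; first exact: subspace_add.
rewrite (linD (rhit_lin fL)) (linD (lhit_lin fL)).
have [Dr Dl] := hD _ fL _ Dy; have [Er El] := hE _ fL _ Ez.
by split; [exists (rhit f y), (rhit f z)|exists (lhit f y), (lhit f z)].
Qed.

Lemma hitsub_cap D E : hitsub D -> hitsub E -> hitsub (capsp D E).
Proof.
move=> [sD hD] [sE hE]; split=> [|f fL x [Dx Ex]]; first exact: subspace_cap.
have [Dr Dl] := hD _ fL _ Dx; have [Er El] := hE _ fL _ Ex.
by [].
Qed.

Lemma hitsub_line1 : hitsub (line 1).
Proof.
split=> [|f fL _ [a ->]]; first exact: subspace_line.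
rewrite (linZ (rhit_lin fL)) (linZ (lhit_lin fL)) rhit1 // lhit1 // scalerA.
by split; exists (a * f 1).
Qed.

Definition hit_op (k : H -> H) : Prop := exists2 f, linF f & k = rhit f \/ k = lhit f.

Lemma hitsub_stable D : hitsub D <-> subspace D /\ stable hit_op D.
Proof.
split=> [[sD hD]|[sD hD]]; split=> //.
  by move=> k [f fL [->|->]] x Dx; case: (hD _ fL _ Dx).
by move=> f fL x Dx; split; apply: hD => //; exists f => //; [left|right].
Qed.

Lemma maximal_hitsub D (x : H) : hitsub D -> ~ D x -> exists M, [/\ hitsub M, forall y, D y -> M y, ~ M x
  & forall N, hitsub N -> (forall y, M y -> N y) -> ~ N x -> forall y, N y -> M y].
Proof.
move=> /hitsub_stable[sD oD] nDx.
have x0 : x <> 0 by move=> x0; apply: nDx; rewrite x0; apply: sD.1.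
(* As [x] is nonzero, meeting [eq x] only in 0 means not containing [x]. *)
have [|M [[sM oM] DM Mx Mmax]] := maximal_stable_avoiding (W := eq x) sD oD.
  by move=> y Dy xy; case: nDx; rewrite xy.
exists M; split=> //; first exact/hitsub_stable.
  by move=> /Mx/(_ erefl).
move=> N /hitsub_stable[sN oN] MN nNx; apply: Mmax => // y Ny xy.
by case: nNx; rewrite xy.
Qed.

(** * Integrals, their composition with the antipode, and nondegeneracy *)

Definition right_integral (I : H -> F) : Prop :=
  linF I /\ forall x, lhit I x = I x *: 1.

Lemma left_integralE I W (g : H -> W) x : left_integral I -> lin g ->
  \D_(u, v <- x) I v *: g u = I x *: g 1.
Proof.
move=> [IL Iint] gL; rewrite -(linZ gL) -Iint (lin_sum gL).
by apply: eq_bigr => p _; rewrite (linZ gL).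
Qed.

Lemma right_integralE I W (g : H -> W) x : right_integral I -> lin g ->
  \D_(u, v <- x) I u *: g v = I x *: g 1.
Proof.
move=> [IL Iint] gL; rewrite -(linZ gL) -Iint (lin_sum gL).
by apply: eq_bigr => p _; rewrite (linZ gL).
Qed.

(** Invariance of [I] at [S(x_1)] replaces [I(S(x_1)) x_2] by [I(S(x_1)_2) S(x_1)_1 x_2], which
    [sw_anti_cancel] evaluates. *)
Lemma right_integral_anti I : left_integral I -> right_integral (I \o @hanti F H).
Proof.
move=> Iint; have IL := Iint.1; split; first by rewrite /comp; lin_auto.
move=> x; rewrite -(sw_anti_cancel (phi := fun c d => I d *: c)); last by lin_auto.
by apply: eq_sw => a b; rewrite (left_integralE (g := fun c => c * b)) ?mul1r //; lin_auto.
Qed.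

(** Inserting [S(c_1) c_2] gives [S(c_1) c_2 x_1 I(c_3 x_2)], and invariance applies to the product
    of [c_2] and [x] in the relabelled sum. *)
Lemma left_integral_shift I c x : left_integral I ->
  \D_(u, v <- x) I (c * v) *: u = \D_(a, b <- c) I (b * x) *: hanti a.
Proof.
move=> Iint; have IL := Iint.1.
rewrite -(@sw_counitl _ _ _ (fun c => \D_(u, v <- x) I (c * v) *: u)); last by lin_auto.
transitivity (\D_(e, b2 <- c) \D_(a, b1 <- e) \D_(u, v <- x) I (b2 * v) *: (hanti a * b1 * u)).
  apply: eq_sw => e b2.
  rewrite (@sw_antil _ _ _ (fun z => \D_(u, v <- x) I (b2 * v) *: (z * u))); last by lin_auto.
  by under [in RHS]eq_sw => u v do rewrite mul1r.
rewrite (@sw_coassoc _ _ _ (fun a b1 b2 => \D_(u, v <- x) I (b2 * v) *: (hanti a * b1 * u))); last by lin_auto.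
apply: eq_sw => a b.
rewrite -[hanti a in RHS]mulr1 -(@left_integralE I _ ( *%R (hanti a))) //; last by lin_auto.
rewrite (sw_mul (phi := fun u v => I v *: (hanti a * u))); last by lin_auto.
by apply: eq_sw => b1 b2; apply: eq_sw => u v; rewrite mulrA.
Qed.

(** The radical [K] is stable under left hits by the shift formula. The counit vanishes on it,
    because [heps y * I h] is the sum of the [I(h S(y_1) y_2)] and the right legs can be taken to be
    left hits of [y]. Hence [f x = heps (lhit f x)] is 0 for every [f]. *)
Lemma left_integral_nondegenerate I x : left_integral I -> (exists h, I h <> 0) ->
  (forall c, I (c * x) = 0) -> x = 0.
Proof.
move=> Iint [h Ih]; have IL := Iint.1; pose K x := forall c, I (c * x) = 0.
rewrite -/(K x) => Kx.
have Khit f y : linF f -> K y -> K (lhit f y).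
  move=> fL Ky c.
  have -> : I (c * lhit f y) = f (\D_(u, v <- y) I (c * v) *: u).
    rewrite /lhit /sw mulr_sumr (linF_sum IL) (linF_sum fL).
    by apply: eq_bigr => p _; rewrite -scalerAr (linFZ IL) (linFZ fL) mulrC.
  rewrite left_integral_shift // /sw big1 ?(linF0 fL) // => p _.
  by rewrite Ky scale0r.
have Keps y : K y -> heps y = 0.
  move=> Ky; apply: boolp.contrapT => /eqP y0; apply: Ih.
  suff : heps y * I h = 0 by move/eqP; rewrite mulf_eq0 (negPf y0) => /eqP.
  have gL : lin (fun z => I (h * z) : F^o) by lin_auto.
  transitivity (sw (fun u v => I (h * (hanti u * v)) : F^o) y).
    by rewrite -[X in _ * I X]mulr1; symmetry; apply: (sw_antil y gL).
  have [n [v [phi [phiL _ E]]]] := comul_dual y.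
  rewrite (E F^o (fun u v => I (h * (hanti u * v)))); last by lin_auto.
  by rewrite big1 // => i _; rewrite mulrA; apply: Khit.
apply: functionals_separate => f fL; rewrite (linF0 fL) -eps_lhit //.
exact/Keps/Khit.
Qed.

(** If [I] vanished on all antipodes, the shift formula would put [lhit I x] in the radical of [I],
    so it would be 0, and with it [I x], its counit. *)
Lemma left_integral_anti_neq0 I : left_integral I -> (exists h, I h <> 0) ->
  exists h, I (hanti h) <> 0.
Proof.
move=> Iint Inz; have [x Ix] := Inz; have IL := Iint.1; apply: boolp.contrapT => nS.
have S0 h : I (hanti h) = 0 by apply: boolp.contrapT => hN; apply: nS; exists h.
apply: Ix; rewrite -eps_lhit //.
rewrite (left_integral_nondegenerate (x := lhit I x) Iint Inz) ?(linF0 (he_lin (hax H))) //.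
move=> c.
have -> : I (c * lhit I x) = I (\D_(u, v <- x) I (c * v) *: u).
  rewrite /lhit /sw mulr_sumr !(linF_sum IL).
  by apply: eq_bigr => p _; rewrite -scalerAr !(linFZ IL) mulrC.
rewrite left_integral_shift // /sw (linF_sum IL) big1 // => p _.
by rewrite (linFZ IL) S0 mulr0.
Qed.
End Hits.

(** * Cosemisimplicity and integrals *)

Section Cosemisimple.
Variables (F : fieldType) (H : hopf F).
Implicit Types (W : lmodType F) (x y : H) (f g I J : H -> F) (D : H -> Prop).

Lemma hitsub0 : hitsub (fun x : H => x = 0).
Proof.
split=> [|f fL x ->]; first by split=> // a x y -> ->; rewrite scaler0 addr0.
by rewrite (lin0 (rhit_lin fL)) (lin0 (lhit_lin fL)).
Qed.

(** By adjunction a test functional [g] moves to the other side, where [f] is evaluated at a hit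
    that stays in [D]. The next three lemmas use the same argument. *)
Lemma rhit_vanishing D f x : hitsub D -> linF f -> (forall y, D y -> f y = 0) -> D x -> rhit f x = 0.
Proof.
move=> [sD hD] fL f0 Dx; apply: functionals_separate => g gL.
by rewrite hit_adj // f0 ?(linF0 gL) //; apply: (hD _ gL _ Dx).2.
Qed.

Lemma lhit_vanishing D f x : hitsub D -> linF f -> (forall y, D y -> f y = 0) -> D x -> lhit f x = 0.
Proof.
move=> [sD hD] fL f0 Dx; apply: functionals_separate => g gL.
by rewrite -hit_adj // f0 ?(linF0 gL) //; apply: (hD _ gL _ Dx).1.
Qed.

Lemma rhit_counit_on D f x : hitsub D -> linF f -> (forall y, D y -> f y = heps y) -> D x -> rhit f x = x.
Proof.
move=> [sD hD] fL fe Dx; apply: functionals_separate => g gL.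
by rewrite hit_adj // fe ?eps_lhit //; apply: (hD _ gL _ Dx).2.
Qed.

Lemma lhit_counit_on D f x : hitsub D -> linF f -> (forall y, D y -> f y = heps y) -> D x -> lhit f x = x.
Proof.
move=> [sD hD] fL fe Dx; apply: functionals_separate => g gL.
by rewrite -hit_adj // fe ?eps_rhit //; apply: (hD _ gL _ Dx).1.
Qed.

Lemma simple_hitsub D E : simple_subcoalg D -> hitsub E -> (forall x, E x -> D x) ->
  (forall x, E x -> x = 0) \/ (forall x, D x -> E x).
Proof. by move=> [_ [_ Dmin]] /subcoalgP; apply: Dmin. Qed.

(* If a simple subcoalgebra [E] is contained neither in [D] nor in the line of [1], then
   [1 = d + e] with [d] in [D] and [e] in [E]; hitting with a functional equal to [0] on [D]
   and to the counit on [E] maps [1] both to a multiple of [1] and to [e]. *)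
Lemma maximal_without1 D : hitsub D -> ~ D 1 ->
  (forall N, hitsub N -> (forall y, D y -> N y) -> ~ N 1 -> forall y, N y -> D y) ->
  cosemisimple H -> forall x, addsp D (line 1) x.
Proof.
move=> hD nD1 Dmax css x; have [sD _] := hD; have sD1 := subspace_add sD (subspace_line (1 : H)).
have [s [Es ->]] := css x; apply: subspace_sum => // {x} x /Es[E [sE Ex]].
have hE : hitsub E by apply/subcoalgP; case: sE.
have [|DE|ED] := simple_hitsub sE (hitsub_cap hD hE); first by move=> y [].
- suff Eline : forall y, E y -> line 1 y by apply: addspr; [exact: sD.1|exact: Eline].
  apply: boolp.contrapT => nEl.
  have [E1|nE1] := boolp.EM (E 1).
    have [y [a ->]|L|//] := simple_hitsub sE (hitsub_line1 H).
      by apply: subspaceZ => //; case: hE.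
    have /L/eqP : line 1 (1 : H) by exists 1; rewrite scale1r.
    by rewrite oner_eq0.
  have nDE : ~ forall y, E y -> D y.
    move=> ED; apply: nEl => y Ey; rewrite (DE y); last by split=> //; apply: ED.
    by exists 0; rewrite scale0r.
  apply: nDE => y Ey; apply: (Dmax _ (hitsub_add hD hE)); last by apply: addspr => //; exact: sD.1.
    by move=> z Dz; apply: addspl => //; case: hE => [[]].
  move=> [d [e [Dd Ee de]]].
  have [p [pL pE pid pD]] := projection_killing sD hE.1 (fun y Dy Ey => DE y (conj Dy Ey)).
  have fL : linF (fun y => heps (p y)) by have := he_lin (hax H) => eL; lin_auto.
  have := rhit1 fL; rewrite [X in rhit _ X]de (linD (rhit_lin fL)).
  rewrite (rhit_vanishing hD) // => [|z Dz]; last by rewrite pD // (linF0 (he_lin (hax H))).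
  rewrite (rhit_counit_on hE) // => [|z Ez]; last by rewrite pid.
  rewrite add0r; set a := heps _ => ea; have [a0|a0] := eqVneq a 0.
    by apply: nD1; rewrite de ea a0 scale0r addr0.
  by apply: nE1; rewrite -[1]scale1r -(mulVf a0) -scalerA -ea; apply: subspaceZ => //; case: hE.
- by apply: addspl; [exact: (subspace_line _).1|case: (ED _ Ex)].
Qed.

(** [J] is the coefficient of [1] along a maximal subcoalgebra [M] avoiding [1]. Since [J] vanishes
    on [M], so do both hits by [J], which makes it an integral on both sides. *)
Lemma cosemisimple_integral : cosemisimple H ->
  exists J : H -> F, [/\ left_integral J, right_integral J & J 1 = 1].
Proof.
move=> css.
have [|M [hM _ nM1 Mmax]] := maximal_hitsub (x := 1) hitsub0; first by move/eqP; rewrite oner_eq0.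
have cover := maximal_without1 hM nM1 Mmax css; have sM := hM.1.
have [|p [pL p1 pid pM]] := projection_killing sM (subspace_line (1 : H)).
  move=> y My [a ya]; have [a0|a0] := eqVneq a 0; first by rewrite ya a0 scale0r.
  by case: nM1; rewrite -[1]scale1r -(mulVf a0) -scalerA -ya; apply: subspaceZ.
have eL := he_lin (hax H).
pose J x := heps (p x).
have JL : linF J by rewrite /J; lin_auto.
have JM y : M y -> J y = 0 by move=> My; rewrite /J pM // (linF0 eL).
have J1 : J 1 = 1 by rewrite /J pid ?(he_one (hax H)) //; exists 1; rewrite scale1r.
have JE y a : M y -> J (y + a *: 1) = a.
  by move=> My; rewrite (linFD JL) (linFZ JL) JM // J1 add0r mulr1.
exists J; split=> //; split=> // x; have [y [_ [My [a ->] ->]]] := cover x; rewrite JE //.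
  change (rhit J (y + a *: 1) = a *: 1); rewrite (linD (rhit_lin JL)) (linZ (rhit_lin JL)) rhit1 //.
  by rewrite (rhit_vanishing hM) // J1 scale1r add0r.
rewrite (linD (lhit_lin JL)) (linZ (lhit_lin JL)) lhit1 //.
by rewrite (lhit_vanishing hM) // J1 scale1r add0r.
Qed.

(** * Splitting subcoalgebras with a normalized right integral *)

Section Complement.
Variable J : H -> F.
Hypotheses (Jint : right_integral J) (J1 : J 1 = 1).

(** Right invariance turns [c_1 J(S(c_2) d)] into [c_1 S(c_2) d_2 J(S(c_3) d_1)], where [c_1 S(c_2)]
    collapses. *)
Lemma coseparability (c d : H) :
  \D_(u, v <- c) J (hanti v * d) *: u = \D_(a, b <- d) J (hanti c * a) *: b.
Proof.
have JL := Jint.1.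
rewrite -(@sw_counitl _ _ _ (fun c => \D_(a, b <- d) J (hanti c * a) *: b)); last by lin_auto.
transitivity (\D_(e, w <- c) \D_(u, v <- e) \D_(a, b <- d) J (hanti w * a) *: (u * hanti v * b)).
  rewrite (@sw_coassoc _ _ _ (fun u v w => \D_(a, b <- d) J (hanti w * a) *: (u * hanti v * b))); last by lin_auto.
  apply: eq_sw => u v.
  rewrite -[u in LHS]mulr1 -(@right_integralE _ _ J _ ( *%R u)) //; last by lin_auto.
  rewrite (sw_mul (phi := fun a b => J a *: (u * b))); last by lin_auto.
  rewrite (sw_anti (phi := fun p q => \D_(a, b <- d) J (p * a) *: (u * (q * b)))); last by lin_auto.
  by apply: eq_sw => a b; apply: eq_sw => p q; rewrite mulrA.
apply: eq_sw => e w.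
rewrite (@sw_antir _ _ _ (fun z => \D_(a, b <- d) J (hanti w * a) *: (z * b))); last by lin_auto.
by under eq_sw => u v do rewrite mul1r.
Qed.

(* Averaging a linear projection onto [D] on either side gives functionals [e] and [e']
   such that [lhit e] and [rhit e'] are projections onto [D]; since left and right hits
   commute these two projections coincide, hence the kernel is stable on both sides. *)
Lemma hitsub_complement D : hitsub D -> exists r : H -> H,
  [/\ lin r, forall x, D (r x), forall x, D x -> r x = x & hitsub (fun x => r x = 0)].
Proof.
move=> hD; have [sD Dh] := hD; have JL := Jint.1; have eL := he_lin (hax H).
have [|p [pL pD pid _]] := projection_killing hitsub0.1 sD; first by [].
pose e x : F^o := \D_(u, v <- x) (J (hanti (p u) * v) : F^o).
pose e' x : F^o := \D_(u, v <- x) (J (hanti u * p v) : F^o).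
have tauE x : D x -> \D_(u, v <- x) (J (hanti u * v) : F^o) = heps x.
  move=> Dx; have gL : lin (fun z => J z : F^o) by lin_auto.
  by apply: etrans (sw_antil x gL) _; rewrite J1; apply: mulr1.
have eFL : linF e by rewrite /e; lin_auto.
have e'FL : linF e' by rewrite /e'; lin_auto.
have eD x : D x -> e x = heps x.
  move=> Dx; rewrite -tauE // /e; have [n [v [phi [phiL Dv E]]]] := comul_dual x.
  rewrite (E F^o (fun u v => J (hanti (p u) * v))); last by lin_auto.
  rewrite (E F^o (fun u v => J (hanti u * v))); last by lin_auto.
  apply: eq_bigr => i _; rewrite pid //.
  by have [f fL ->] := Dv i; apply: (Dh _ fL _ Dx).1.
have e'D x : D x -> e' x = heps x.
  move=> Dx; rewrite -tauE // /e'; have [n [v [phi [phiL _ E]]]] := comul_dual x.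
  rewrite (E F^o (fun u v => J (hanti u * p v))); last by lin_auto.
  rewrite (E F^o (fun u v => J (hanti u * v))); last by lin_auto.
  by apply: eq_bigr => i _; rewrite pid //; apply: (Dh _ (phiL i) _ Dx).2.
have De x : D (lhit e x).
  (* Coseparability trades the outer leg for a right hit of [p u], which is in [D]. *)
  have -> : lhit e x = \D_(u, w <- x) rhit (fun t => J (hanti t * w)) (p u).
    transitivity (\D_(a, b <- x) \D_(u, v <- a) J (hanti (p u) * v) *: b).
      by apply: eq_sw => a b; rewrite /e /sw scaler_suml.
    rewrite (@sw_coassoc _ _ _ (fun u v b => J (hanti (p u) * v) *: b)); last by lin_auto.
    by apply: eq_sw => u w; rewrite -coseparability.
  apply: subspace_sum => // q _.
  have fL : linF (fun t => J (hanti t * q.2)) by lin_auto.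
  exact: (Dh _ fL _ (pD _)).1.
have De' x : D (rhit e' x).
  have -> : rhit e' x = \D_(w, v <- x) lhit (fun t => J (hanti w * t)) (p v).
    transitivity (\D_(a, b <- x) \D_(u, v <- b) J (hanti u * p v) *: a).
      by apply: eq_sw => a b; rewrite /e' /sw scaler_suml.
    rewrite -(@sw_coassoc _ _ _ (fun a u v => J (hanti u * p v) *: a)); last by lin_auto.
    by apply: eq_sw => u w; rewrite coseparability.
  apply: subspace_sum => // q _.
  have fL : linF (fun t => J (hanti q.1 * t)) by lin_auto.
  exact: (Dh _ fL _ (pD _)).2.
have ee' x : rhit e' x = lhit e x.
  by rewrite -[LHS](lhit_counit_on hD eFL) // hitC // (rhit_counit_on hD).
exists (lhit e); split=> //; first exact: lhit_lin.
  by move=> x; apply: (lhit_counit_on hD).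
split=> [|f fL x rx]; first exact/subspace_ker/lhit_lin.
split; first by rewrite hitC // rx (lin0 (rhit_lin fL)).
by rewrite -ee' -hitC // ee' rx (lin0 (lhit_lin fL)).
Qed.

(** If the sum [Sg] of the simple subcoalgebras misses [c], enlarge it to a maximal subcoalgebra [M]
    missing [c]. A complement [N] of [M] turns out to be simple, so it lies in [M], although [c] has
    a nonzero component in [N]. *)
Lemma integral_cosemisimple : cosemisimple H.
Proof.
move=> c; apply: boolp.contrapT.
pose Sg (x : H) := exists s : seq H,
  (forall x, x \in s -> exists D, simple_subcoalg D /\ D x) /\ x = \sum_(x <- s) x.
rewrite -/(Sg c) => nc.
have sSg : subspace Sg.
  split; first by exists [::]; rewrite big_nil.
  move=> a _ _ [s [Ds ->]] [s' [Ds' ->]]; exists ([seq a *: x | x <- s] ++ s'); split.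
    move=> x; rewrite mem_cat => /orP[/mapP[y /Ds[D [sD Dy] ->]]|/Ds'//].
    exists D; split=> //; apply: subspaceZ => //.
    by case: sD => /subcoalgP[].
  by rewrite big_cat big_map scaler_sumr.
have incl D x : simple_subcoalg D -> D x -> Sg x.
  move=> sD Dx; exists [:: x]; rewrite big_seq1; split=> // y; rewrite inE => /eqP->.
  by exists D.
have hSg : hitsub Sg.
  split=> // f fL _ [s [Ds ->]]; rewrite (lin_sum (rhit_lin fL)) (lin_sum (lhit_lin fL)).
  split; apply: subspace_sum => // x /Ds[D [sD Dx]]; apply: (incl D) => //;
    have [/subcoalgP[_ Dh] _] := sD; by case: (Dh _ fL _ Dx).
have [M [hM SM nMc Mmax]] := maximal_hitsub hSg nc; have sM := hM.1.
have [r [rL rM rid hN]] := hitsub_complement hM; pose N x := r x = 0.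
have Ncap x : M x -> N x -> x = 0 by move=> Mx Nx; rewrite -(rid x).
(* Maximality of [M]: adding any nonzero subcoalgebra of [N] captures [c]. *)
have up E x : hitsub E -> (forall x, E x -> N x) -> E x -> x <> 0 -> addsp M E c.
  move=> hE EN Ex x0; apply: boolp.contrapT => nME; apply: x0; apply: (Ncap); last exact: EN.
  apply: (Mmax _ (hitsub_add hM hE)) => //; last by apply: addspr => //; exact: sM.1.
  by move=> y My; apply: addspl => //; exact: hE.1.1.
have Nc : N (c - r c) by rewrite /N (linB rL) (rid (r c)) // subrr.
have cr0 : c - r c <> 0 by move/eqP; rewrite subr_eq0 => /eqP cr; apply: nMc; rewrite cr.
apply: cr0; apply: (Ncap) => //; apply: SM; apply: (incl N) => //.
split; first exact/subcoalgP.
split; first by exists (c - r c); split=> // /eqP; rewrite subr_eq0 => /eqP cr; apply: nMc; rewrite cr.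
move=> E /subcoalgP hE EN; apply: boolp.contrapT => /boolp.not_orP[].
move=> /boolp.existsNP[x /boolp.not_implyP[Ex x0]] /boolp.existsNP[n /boolp.not_implyP[Nn nEn]].
(* A proper nonzero [E] has a nonzero complement inside [N], so [c] decomposes along both. *)
have [q [qL qE qid hK]] := hitsub_complement hE.
have hNK : hitsub (capsp N (fun x => q x = 0)) by apply: hitsub_cap.
have [m1 [e1 [Mm1 Ee1 c1]]] := up E x hE EN Ex x0.
have [||m2 [e2 [Mm2 [Ne2 qe2] c2]]] := up _ (n - q n) hNK (fun _ => @proj1 _ _).
- split; last by rewrite (linB qL) (qid (q n)) // subrr.
  by apply: subspaceB => //; [exact: hN.1|exact: EN].
- by move/eqP; rewrite subr_eq0 => /eqP nq; apply: nEn; rewrite nq.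
(* [M] and [N] meet only in 0, so the two components of [c] agree; lying in [E] and in its
   complement, they vanish. *)
have e12 : e2 = e1.
  apply/eqP; rewrite -subr_eq0; apply/eqP; apply: Ncap; last by apply: subspaceB (hN.1) Ne2 (EN _ Ee1).
  have -> : e2 - e1 = m1 - m2; last exact: subspaceB.
  by apply/eqP; rewrite subr_eq addrAC eq_sym subr_eq -c1 addrC -c2.
by apply: nMc; rewrite c1 -(qid e1) // -e12 qe2 addr0.
Qed.
End Complement.
End Cosemisimple.

(** * Hopf algebra maps and extension of integrals *)

Section HopfMap.
Variables (F : fieldType) (A B : hopf F) (f : A -> B).
Hypothesis fH : hopf_map f.

Lemma hopf_map_lin : lin f. Proof. by case: fH. Qed.
Lemma hopf_mapM x y : f (x * y) = f x * f y. Proof. by case: fH => _ []. Qed.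
Lemma hopf_map1 : f 1 = 1. Proof. by case: fH => _ [_ []]. Qed.
Lemma hopf_map_eps x : heps (f x) = heps x. Proof. by case: fH => _ [_ [_ []]]. Qed.

Lemma sw_hopf_map (W : lmodType F) (phi : B -> B -> W) a : lin2 phi ->
  sw phi (f a) = \D_(u, v <- a) phi (f u) (f v).
Proof.
move=> phiL; apply: functionals_separate => g gL; rewrite /sw !(linF_sum gL).
have pL : bilin (fun u v => g (phi u v)) by lin_auto.
by case: fH => _ [_ [_ [_ /(_ _ pL)]]]; apply.
Qed.

(** Uniqueness of convolution inverses: both sides are inverse to [f], and the triple convolution
    product is evaluated in two ways. *)
Lemma hopf_map_anti a : f (hanti a) = hanti (f a).
Proof.
have fL := hopf_map_lin.
rewrite -[RHS](@sw_counitr _ _ _ (fun u => hanti (f u))); last by lin_auto.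
transitivity (\D_(u, v <- a) \D_(b, c <- v) hanti (f u) * (f b * f (hanti c))); last first.
  apply: eq_sw => u v; under eq_sw => b c do rewrite -hopf_mapM.
  by rewrite (@sw_antir _ _ _ (fun z => hanti (f u) * f z)) ?hopf_map1 ?mulr1 //; lin_auto.
rewrite -(@sw_coassoc _ _ _ (fun u b c => hanti (f u) * (f b * f (hanti c)))); last by lin_auto.
rewrite -[LHS](@sw_counitl _ _ _ (fun c => f (hanti c))); last by lin_auto.
apply: eq_sw => e c.
transitivity (\D_(p, q <- f e) hanti p * q * f (hanti c)).
  by rewrite (@sw_antil _ _ _ (fun z => z * f (hanti c))) ?hopf_map_eps ?mul1r //; lin_auto.
by rewrite sw_hopf_map; [apply: eq_sw => u b; rewrite mulrA|lin_auto].
Qed.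

Lemma hopf_map_rhit (I : B -> F) a : linF I -> f (rhit (I \o f) a) = rhit I (f a).
Proof.
move=> IL; rewrite /rhit (sw_map _ _ hopf_map_lin) sw_hopf_map; last by lin_auto.
by apply: eq_sw => u v; rewrite (linZ hopf_map_lin).
Qed.

Lemma hopf_map_lhit (I : B -> F) a : linF I -> f (lhit (I \o f) a) = lhit I (f a).
Proof.
move=> IL; rewrite /lhit (sw_map _ _ hopf_map_lin) sw_hopf_map; last by lin_auto.
by apply: eq_sw => u v; rewrite (linZ hopf_map_lin).
Qed.

Lemma left_integral_restrict (I : B -> F) : injective f -> left_integral I -> left_integral (I \o f).
Proof.
move=> finj [IL Iint]; have fL := hopf_map_lin; split; first by rewrite /comp; lin_auto.
move=> a; apply: finj; rewrite (linZ fL) hopf_map1 /= -Iint.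
exact: hopf_map_rhit.
Qed.

Lemma right_integral_restrict (I : B -> F) : injective f -> right_integral I -> right_integral (I \o f).
Proof.
move=> finj [IL Iint]; have fL := hopf_map_lin; split; first by rewrite /comp; lin_auto.
by move=> a; apply: finj; rewrite (linZ fL) hopf_map1 /= -Iint hopf_map_lhit.
Qed.
End HopfMap.

(** * Extending integrals from [A] to [B] *)

Section Induction.
Variables (F : fieldType) (A B C : hopf F) (iota : A -> B) (pi : B -> C).
Hypothesis ex : exact_hopf_seq iota pi.

Let iotaH : hopf_map iota. Proof. by case: ex. Qed.
Let piH : hopf_map pi. Proof. by case: ex => _ []. Qed.
Let iota_inj : injective iota. Proof. by case: ex => _ [_ []]. Qed.
Let coinvP b : rcoinv pi b <-> exists a, b = iota a. Proof. by case: ex => _ [_ [_ [_ []]]]. Qed.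

Lemma rcoinvE (W : lmodType F) (phi : B -> C -> W) b : rcoinv pi b -> lin2 phi ->
  \D_(u, v <- b) phi u (pi v) = phi b 1.
Proof.
move=> bP phiL; apply: functionals_separate => g gL; rewrite /sw (linF_sum gL).
have := bP (fun u v => g (phi u v)); rewrite /tev /rcoact big_map big_seq1 /=.
by apply; lin_auto.
Qed.

(* The integral of [B] is the integral of [A] composed with the projection
   [b |-> b_1 J (pi b_2)] of [B] onto its coinvariants. *)
Lemma left_integral_extend (IA : A -> F) (J : C -> F) : left_integral IA -> left_integral J -> J 1 = 1 ->
  exists I : B -> F, left_integral I /\ forall a, I (iota a) = IA a.
Proof.
move=> IAint Jint J1; have JL := Jint.1; have IAL := IAint.1.
have piL := hopf_map_lin piH; have iotaL := hopf_map_lin iotaH.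
have JpL : linF (J \o pi) by rewrite /comp; lin_auto.
pose E := rhit (J \o pi); have EL : lin E by exact: rhit_lin.
(* [E] is left [B]-colinear: the coproduct of [E b] is [b_1 (x) E b_2]. *)
have EE (W : lmodType F) (phi : B -> B -> W) b : lin2 phi ->
    sw phi (E b) = \D_(u, w <- b) phi u (E w).
  move=> phiL; rewrite /E /rhit (sw_map _ _ (sw_lin phiL)).
  transitivity (\D_(e, v <- b) \D_(u, w <- e) J (pi v) *: phi u w).
    by apply: eq_sw => e v; rewrite (linZ (sw_lin phiL)) /sw scaler_sumr.
  rewrite (@sw_coassoc _ _ _ (fun u w v => J (pi v) *: phi u w)); last by lin_auto.
  apply: eq_sw => u w; rewrite (sw_map _ _ (phiL.2 _)).
  by apply: eq_sw => s t; rewrite (linZ (phiL.2 _)).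
(* Invariance of [J] replaces [b_1 (x) pi(b_2) J(pi b_3)] by [b_1 J(pi b_2) (x) 1]. *)
have Ecoinv b : rcoinv pi (E b).
  move=> phi phiL; rewrite /tev /rcoact big_map big_seq1 /=.
  have := EE F^o (fun u v => phi u (pi v)) b; rewrite {1}/sw => ->; last by lin_auto.
  have p1L : lin (fun z => phi z 1 : F^o) by lin_auto.
  have -> : phi (E b) 1 = \D_(u, v <- b) (J (pi v) *: (phi u 1 : F^o)).
    by apply: etrans (sw_map _ _ p1L) _; apply: eq_sw => u v; apply: (linZ p1L).
  apply: (@eq_sw _ _ F^o) => u w.
  have puL : lin (phi u : C -> F^o) by lin_auto.
  apply: etrans (left_integralE (pi w) Jint puL); rewrite (sw_hopf_map piH); last by lin_auto.
  have pL : lin (fun v => phi u (pi v) : F^o) by lin_auto.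
  by apply: etrans (sw_map _ _ pL) _; apply: eq_sw => s t; apply: (linZ pL).
have Eiota a : E (iota a) = iota a.
  rewrite /E /rhit (rcoinvE (phi := fun u c => J c *: u)) ?J1 ?scale1r //; last by lin_auto.
  by apply/coinvP; exists a.
have /boolp.choice[al Hal] : forall b, exists a, E b = iota a by move=> b; apply/coinvP.
have alE b : al b = al (E b) by apply: iota_inj; rewrite -Hal -Hal (Hal b) Eiota.
have ali a : al (iota a) = a by apply: iota_inj; rewrite -Hal Eiota.
have alL : lin al by move=> k x y; apply: iota_inj; rewrite iotaL -!Hal EL.
exists (IA \o al); split=> [|a]; last by rewrite /= ali.
split=> [|b]; first by rewrite /comp; lin_auto.
(* As [al v = al (E v)], colinearity moves [E] onto [b]; the coproduct of [E b] then comes from [A],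
   where [IA] is an integral. *)
transitivity (\D_(u, v <- E b) IA (al v) *: u).
  by rewrite EE; [apply: eq_bigr => p _; rewrite -alE|lin_auto].
rewrite (Hal b) sw_hopf_map //; last by lin_auto.
transitivity (iota (rhit IA (al b))).
  by rewrite /rhit (sw_map _ _ iotaL); apply: eq_sw => u v; rewrite ali (linZ iotaL).
by rewrite /rhit /sw IAint.2 (linZ iotaL) (hopf_map1 iotaH).
Qed.
End Induction.

(** * Duals of finite-dimensional right coideals *)

Section Comodules.
Variables (F : fieldType) (C : hopf F).

Lemma trivial_comod_axioms (M : lmodType F) : lcomod_axioms (C := C) (fun m : M => [:: (1 : C, m)]).
Proof.
split=> [phi phiL|phi [p1 [p2 p3]] m|m].
- by move=> a x y; rewrite /tev !big_seq1; apply: phiL.2.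
- rewrite !big_seq1 /=.
  by apply: (hd_one (hax C) (phi := fun a b => phi a b m)).
- by rewrite big_seq1 /= (he_one (hax C)) scale1r.
Qed.

Definition trivial_comod (M : lmodType F) : lcomod C := LComod (trivial_comod_axioms M).

Section Dual.
Variables (V : C -> Prop) (n : nat) (v : 'I_n -> C) (phi : 'I_n -> C -> F).
Hypotheses (B : dual_basis V v phi) (Vr : forall f, linF f -> forall x, V x -> V (rhit f x)).

Let phiL i : linF (phi i). Proof. by case: B. Qed.
Let Vv i : V (v i). Proof. by case: B. Qed.

(** Matrix coefficients of [V]: the coproduct of [v j] is the sum of the [v i (x) coef i j]. *)
Definition coef (i j : 'I_n) : C := lhit (phi i) (v j).

Lemma sw_coef (W : lmodType F) (psi : C -> C -> W) i j : lin2 psi ->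
  sw psi (coef i j) = \sum_k psi (coef i k) (coef k j).
Proof.
move=> psiL; have pL := phiL i.
rewrite /coef [in LHS]/lhit (sw_map _ _ (sw_lin psiL)).
transitivity (\D_(e, q <- v j) \D_(u, p <- e) phi i u *: psi p q).
  rewrite (@sw_coassoc _ _ _ (fun u p q => phi i u *: psi p q)); last by lin_auto.
  by apply: eq_sw => u w; rewrite (linZ (sw_lin psiL)) /sw scaler_sumr.
transitivity (\D_(e, q <- v j) psi (lhit (phi i) e) q).
  apply: eq_sw => e q; rewrite /lhit (sw_map _ _ (psiL.1 _)).
  by apply: eq_sw => u p; rewrite (linZ (psiL.1 _)).
have hL := lhit_lin pL.
by rewrite (comul_expand (psi := fun e q => psi (lhit (phi i) e) q) B) //;
  [move=> f fL; apply: Vr|lin_auto].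
Qed.

Lemma eps_coef i j : heps (coef i j) = (i == j)%:R.
Proof. by rewrite /coef eps_lhit //; case: B. Qed.

(** A row [m] holds the coordinates of a functional on [V] in the dual basis; dualizing makes the
    right coaction of [V] a left one. *)
Definition dual_coact (m : 'rV[F]_n) : seq (C * 'rV[F]_n) :=
  [seq (\sum_i m 0 i *: coef i j, delta_mx 0 j) | j <- index_enum 'I_n].

Let entry_lin j : linF (fun m : 'rV[F]_n => m 0 j).
Proof. by move=> a x y; rewrite !mxE. Qed.

Let comb_lin j : lin (fun m : 'rV[F]_n => \sum_i m 0 i *: coef i j).
Proof. by apply: lin_bigop => i; apply: lin_scalel; apply: entry_lin. Qed.

Lemma dual_comod_axioms : lcomod_axioms dual_coact.
Proof.
split=> [psi psiL|psi psiL m|m].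
- move=> a x y; rewrite /tev !big_map mulr_sumr -big_split /=; apply: eq_bigr => j _.
  by rewrite comb_lin (psiL.1 _).
- rewrite !big_map /=.
  transitivity (\sum_j \sum_i \sum_k (m 0 i * psi (coef i k) (coef k j) (delta_mx 0 j))).
    apply: eq_bigr => j _.
    have pL : lin2 (fun a b => psi a b (delta_mx 0 j) : F^o) by lin_auto.
    apply: etrans (lin_sum (sw_lin pL) _ _ _) _; apply: eq_bigr => i _.
    by rewrite (linZ (sw_lin pL)) sw_coef //; apply: mulr_sumr.
  transitivity (\sum_k \sum_j psi (\sum_i m 0 i *: coef i k) (coef k j) (delta_mx 0 j)).
    rewrite [RHS]exchange_big; apply: eq_bigr => j _; rewrite exchange_big; apply: eq_bigr => k _ /=.
    rewrite (linF_sum (psiL.1 _ _)); apply: eq_bigr => i _.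
    by rewrite (linFZ (psiL.1 _ _)).
  apply: eq_bigr => k _; rewrite /dual_coact big_map; apply: eq_bigr => j _ /=.
  congr (psi _ _ _); rewrite (bigD1 k) //= big1 ?addr0 => [|i ik]; first by rewrite mxE !eqxx scale1r.
  by rewrite mxE (negPf ik) andbF scale0r.
- rewrite big_map [RHS]row_sum_delta; apply: eq_bigr => j _ /=; congr (_ *: _).
  have eL := he_lin (hax C); rewrite (linF_sum eL) (bigD1 j) //= big1 ?addr0 => [|i ij].
    by rewrite (linFZ eL) eps_coef eqxx mulr1.
  by rewrite (linFZ eL) eps_coef (negPf ij) mulr0.
Qed.

Definition dual_comod : lcomod C := LComod dual_comod_axioms.

Definition eval_at (y : C) (m : 'rV[F]_n) : F^o := \sum_i m 0 i * phi i y.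

Lemma eval_at_lin y : lin (eval_at y).
Proof.
apply: lin_bigop => i; apply: (linF_mull (f := fun m : 'rV_n => m 0 i)).
exact: entry_lin.
Qed.

(** Expanding [1] in the basis inside [lhit (phi i) 1 = phi i 1 *: 1] gives the required relation
    between the [coef i j] and the [phi j 1]. *)
Lemma eval_at_comod_map : V 1 -> lcomod_map (M := dual_comod) (N := trivial_comod F^o) (eval_at 1).
Proof.
move=> V1; split=> [|m]; first exact: eval_at_lin.
move=> psi psiL; rewrite /tev /= big_seq1 !big_map /=.
transitivity (psi (\sum_i (m 0 i * phi i 1) *: 1) 1).
  rewrite -[eval_at 1 m]mulr1 (linFZ (psiL.2 _)) -scaler_suml (linFZ (psiL.1 _)).
  by [].
transitivity (\sum_j phi j 1 * psi (\sum_i m 0 i *: coef i j) 1); last first.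
  apply: eq_bigr => j _; rewrite -(linFZ (psiL.2 _)); congr (psi _ _).
  rewrite /eval_at (bigD1 j) //= big1 ?addr0 => [|i ij]; first by rewrite mxE !eqxx mul1r; apply: mulr1.
  by rewrite mxE (negPf ij) andbF mul0r.
under [RHS]eq_bigr => j _ do rewrite -(linFZ (psiL.1 _)).
rewrite -(linF_sum (psiL.1 _)); congr (psi _ _).
under [RHS]eq_bigr => j _ do rewrite scaler_sumr.
rewrite exchange_big /=; apply: eq_bigr => i _.
have E1 : 1 = \sum_j phi j 1 *: v j by case: B => _ _ _; apply.
have hL := lhit_lin (phiL i).
rewrite -scalerA -lhit1 // [X in lhit _ X]E1 (lin_sum hL) scaler_sumr; apply: eq_bigr => j _.
by rewrite (linZ hL) !scalerA mulrC.
Qed.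
End Dual.
End Comodules.

(** * Coflatness *)

Section LocalIntegrals.
Variables (F : fieldType) (C : hopf F).
Implicit Types (V : C -> Prop) (f w : C -> F).

Definition finite_right_coideal V : Prop :=
  [/\ subspace V, forall f, linF f -> forall x, V x -> V (rhit f x)
    & exists s, forall x, V x -> spanned s x].

(** The right integral condition, tested by a functional [f] and imposed on [V] only. *)
Definition colinear_on V w : Prop :=
  linF w /\ forall f x, linF f -> V x -> w (rhit f x) = f 1 * w x.

Lemma finite_right_coideal_add V V' :
  finite_right_coideal V -> finite_right_coideal V' -> finite_right_coideal (addsp V V').
Proof.
move=> [sV Vr [s Vs]] [sV' V'r [s' V's]]; split; first exact: subspace_add.
  move=> f fL _ [y [z [Vy Vz ->]]]; rewrite (linD (rhit_lin fL)).
  by exists (rhit f y), (rhit f z); split=> //; [apply: Vr|apply: V'r].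
by exists (s ++ s') => _ [y [z [/Vs Vy /V's Vz ->]]]; apply: spanned_cat.
Qed.

(** Two successive right hits are one right hit by a convolution product, here [g (lhit f y)]. *)
Lemma finite_right_coideal_rhits x :
  finite_right_coideal (fun y => exists2 f, linF f & y = rhit f x).
Proof.
split; first exact: subspace_rhits; last first.
  by exists (unzip1 (hdelta x)) => _ [f _ ->]; apply: rhits_spanned.
move=> f fL _ [g gL ->]; exists (fun y => g (lhit f y)).
  by have rL := lhit_lin fL; lin_auto.
apply: functionals_separate => h hL; have rL := lhit_lin fL.
have gfL : linF (fun y => g (lhit f y)) by lin_auto.
by rewrite hit_adj // hitC // hit_adj // (hit_adj _ gfL).
Qed.

(* A right integral exists as soon as [1] is not in the span of the [rhit f x] with [f 1 = 0];
   the set [K] below is a subspace containing them, and [1 \notin K] is a local condition. *)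
Lemma right_integral_of_colinear :
  (forall V, finite_right_coideal V -> V 1 -> exists w, colinear_on V w /\ w 1 = 1) ->
  exists J, right_integral (H := C) J /\ J 1 = 1.
Proof.
move=> loc; have eL := he_lin (hax C).
pose K x := exists V, [/\ finite_right_coideal V, V x & forall w, colinear_on V w -> w x = 0].
have sK : subspace K.
  split.
    exists (fun y => exists2 f, linF f & y = rhit f 0); split.
    - exact: finite_right_coideal_rhits.
    - exact: (subspace_rhits _).1.
    - by move=> w [wL _]; apply: linF0.
  move=> a x y [V [fV Vx Vw]] [V' [fV' Vy V'w]]; exists (addsp V V'); split.
  - exact: finite_right_coideal_add.
  - by exists (a *: x), y; split=> //; apply: subspaceZ => //; case: fV.
  - move=> w [wL wc]; rewrite wL Vw ?V'w ?mulr0 ?addr0 //; split=> // f z fL Vz; apply: wc => //.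
      by apply: addspr => //; case: fV => [[]].
    by apply: addspl => //; case: fV' => [[]].
have nK1 : ~ K 1.
  move=> [V [fV V1 Vw]]; have [w [wc w1]] := loc V fV V1.
  by have /eqP := Vw w wc; rewrite w1 oner_eq0.
have Kr f x : linF f -> f 1 = 0 -> K (rhit f x).
  move=> fL f1; exists (fun y => exists2 f, linF f & y = rhit f x); split.
  - exact: finite_right_coideal_rhits.
  - by exists f.
  - move=> w [_ ->]; rewrite ?f1 ?mul0r //.
    (* The counit exhibits [x] as a right hit of itself. *)
    by exists (@heps F C) => //; rewrite /rhit (sw_counitr (g := fun x => x)).
have [J [JL J1 JK]] := functional_separation sK nK1.
exists J; split=> //; split=> // x; apply: functionals_separate => f fL.
rewrite -(hit_adj _ fL JL) (linFZ fL).
have gL : linF (fun y => f y - f 1 * heps y) by apply: linF_comb_sub.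
(* The first functional kills [1], so its hit lies in [K]; the counit acts as the identity. *)
have -> : rhit f x = rhit (fun y => f y - f 1 * heps y) x + f 1 *: x.
  rewrite -{3}[x](sw_counitr (g := fun x => x)) // /rhit /sw scaler_sumr -big_split /=.
  by apply: eq_bigr => p _; rewrite scalerBl scalerA subrK.
rewrite (linFD JL) JK ?add0r ?(linFZ JL) 1?mulrC //; apply: Kr => //.
by rewrite (he_one (hax C)) mulr1 subrr.
Qed.
End LocalIntegrals.

(** * From integrals of [B] to cosemisimplicity of [C] *)

Section Main.
Variables (F : fieldType) (A B C : hopf F) (iota : A -> B) (pi : B -> C).
Hypotheses (ex : exact_hopf_seq iota pi) (cf : faithfully_coflat pi).

Let iotaH : hopf_map iota. Proof. by case: ex. Qed.
Let piH : hopf_map pi. Proof. by case: ex => _ []. Qed.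
Let iota_inj : injective iota. Proof. by case: ex => _ [_ []]. Qed.

(* Evaluation at [1] maps the dual comodule of [V] onto the trivial comodule, so by coflatness
   [iota a (x) 1] lifts to the cotensor product; applying [R] to the lift gives a coinvariant
   of the dual of [V], that is a colinear functional on [V]. *)
Lemma coflat_colinear (R : B -> F) (a : A) (V : C -> Prop) : right_integral R -> R (iota a) = 1 ->
  finite_right_coideal V -> V 1 -> exists w, colinear_on V w /\ w 1 = 1.
Proof.
move=> Rint Ra [sV Vr [s Vs]] V1; have RL := Rint.1; have piL := hopf_map_lin piH.
have [n [v [phi Bs]]] := dual_basis_finite sV Vs; have [phiL Vv dual vspan] := Bs.
(* With the zero comodule [Z] as target of [g], exactness at [N] means that evaluation is onto. *)
pose M := dual_comod Bs Vr; pose N := trivial_comod C F^o; pose Z := trivial_comod C 'rV[F]_0.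
pose g : N -> Z := fun=> 0.
have zero_rV (z : 'rV[F]_0) : z = 0 by apply/rowP => -[].
have gM : lcomod_map g by split=> [c x y|m] //; rewrite /g scaler0 addr0.
have exM : exact_at (eval_at phi 1 : M -> N) g.
  split=> // m _.
  have [j phij] : exists j, phi j 1 != 0.
    apply: boolp.contrapT => nj; have /eqP := vspan 1 V1; rewrite big1 ?oner_eq0 // => j _.
    have [->|pj] := eqVneq (phi j 1) 0; first by rewrite scale0r.
    by case: nj; exists j.
  exists (((m : F) / phi j 1) *: delta_mx 0 j); rewrite /eval_at (bigD1 j) //= big1 ?addr0.
    by rewrite !mxE !eqxx mulr1 mulfVK.
  by move=> i ij; rewrite !mxE (negPf ij) andbF mulr0 mul0r.
have [_ lift] := (cf (eval_at_comod_map Bs Vr V1) gM).1 exM.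
have ia : rcoinv pi (iota a) by case: ex => _ [_ [_ [_ [_ ->]]]]; exists a.
(* Coinvariance of [iota a] places this tensor in the cotensor product of [B] and [N]. *)
have [||t [tM tE]] := lift [:: (iota a, 1)].
- move=> psi psiL; rewrite !big_seq1 /=.
  have pL : bilin (fun b c => psi b c 1) by lin_auto.
  by have := ia _ pL; rewrite /tev !big_seq1.
- by move=> psi psiL; rewrite /tev /= big_seq1 big_nil /= (linF0 (psiL.2 _)).
(* The image of [t] under [R] on the first factor, in coordinates; [w] is the functional it
   represents. *)
pose wc j := \sum_(p <- t) R p.1 * (p.2 : 'rV[F]_n) 0 j.
pose w x := \sum_j wc j * phi j x.
have wL : linF w by apply: (lin_bigop (V := F^o)) => j; apply: linF_mulr.
(* Coinvariance of [wc], tested by [f]: the cotensor condition moves the coaction to [B], where [R]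
   is a right integral. *)
have wcE f j : linF f -> \sum_i wc i * f (coef v phi i j) = f 1 * wc j.
  move=> fL.
  have psiL : trilin (fun b c (m : M) => R b * f c * (m : 'rV[F]_n) 0 j).
    split; [|split].
    - by move=> c m; apply: linF_mull; apply: linF_mull.
    - by move=> b m; apply: linF_mull; apply: linF_mulr.
    - by move=> b c; apply: (linF_mulr (f := fun m : 'rV[F]_n => m 0 j)) => k x y; rewrite !mxE.
  have := tM _ psiL => E; transitivity (\sum_(p <- t) \sum_(q <- lcoact p.2)
      R p.1 * f q.1 * (q.2 : 'rV[F]_n) 0 j).
    rewrite /wc; under eq_bigr => i _ do rewrite mulr_suml.
    rewrite exchange_big /=; apply: eq_bigr => p _; rewrite big_map /=.
    rewrite [RHS](bigD1 j) //= [X in _ + X]big1 ?addr0 => [|i ij]; last first.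
      by rewrite mxE eq_sym (negPf ij) andbF mulr0.
    rewrite mxE !eqxx mulr1 (linF_sum fL) mulr_sumr; apply: eq_bigr => i _.
    by rewrite (linFZ fL) mulrA.
  rewrite -E /wc mulr_sumr; apply: eq_bigr => p _; rewrite big_map /= -mulr_suml mulrA; congr (_ * _).
  have := congr1 (fun z => f (pi z)) (Rint.2 p.1).
  rewrite /lhit /sw (linZ piL) (hopf_map1 piH) (linFZ fL) mulrC => <-.
  rewrite (lin_sum piL) (linF_sum fL); apply: eq_bigr => q _.
  by rewrite (linZ piL) (linFZ fL).
exists w; split; last first.
  have pL : bilin (fun b (y : F^o) => R b * y).
    by split=> [y|b]; [apply: linF_mull|apply: (linF_mulr (f := fun y : F^o => y))].
  have := tE _ pL; rewrite /tev big_map big_seq1 /= Ra mulr1 => <-.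
  rewrite /w /wc; under [LHS]eq_bigr => j _ do rewrite mulr_suml.
  rewrite exchange_big; apply: eq_bigr => p _; rewrite /eval_at mulr_sumr.
  by apply: eq_bigr => j _; rewrite mulrA.
split=> // f x fL Vx; have rL := rhit_lin fL.
have wr j : w (rhit f (v j)) = f 1 * w (v j).
  rewrite /w; under eq_bigr => i _ do rewrite hit_adj //; rewrite wcE //.
  congr (_ * _); rewrite (bigD1 j) //= big1 ?addr0 ?dual ?eqxx ?mulr1 // => i ij.
  by rewrite dual (negPf ij) mulr0.
rewrite (vspan x Vx) (lin_sum rL) !(linF_sum wL) mulr_sumr; apply: eq_bigr => j _.
by rewrite (linZ rL) !(linFZ wL) wr mulrCA.
Qed.

Lemma coflat_cosemisimple (R : B -> F) (a : A) : right_integral R -> R (iota a) <> 0 -> cosemisimple C.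
Proof.
move=> Rint /eqP Ra.
have [J [Jint J1]] : exists J, right_integral (H := C) J /\ J 1 = 1.
  apply: right_integral_of_colinear => V fV V1.
  apply: (coflat_colinear (a := (R (iota a))^-1 *: a) Rint) => //.
  by rewrite (linZ (hopf_map_lin iotaH)) (linFZ Rint.1) mulVf.
exact: integral_cosemisimple Jint J1.
Qed.

(** Nonvanishing after the antipode is needed on [iota(A)], not just on [B]; so it is obtained in
    [A] for the restricted integral and carried over because [iota] commutes with antipodes. *)
Lemma restricted_right_integral (I : B -> F) (a : A) : left_integral I -> I (iota a) <> 0 ->
  exists a', right_integral (I \o @hanti F B) /\ (I \o @hanti F B) (iota a') <> 0.
Proof.
move=> Iint Ia; have IAint := left_integral_restrict iotaH iota_inj Iint.
have [|a' Ia'] := left_integral_anti_neq0 IAint; first by exists a.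
exists a'; split; first exact: right_integral_anti.
by rewrite /= -(hopf_map_anti iotaH).
Qed.
End Main.

Theorem theorem2p14 (F : fieldType) (A B C : hopf F) (iota : A -> B) (pi : B -> C) :
  exact_hopf_seq iota pi -> faithfully_coflat pi ->
  ((exists I : B -> F, left_integral I /\ (exists h, I h <> 0) /\
                       (exists a : A, I (iota a) <> 0))
     <-> co_frobenius A /\ cosemisimple C)
  /\ (cosemisimple B <-> cosemisimple A /\ cosemisimple C).
Proof.
move=> ex cf; have iotaH : hopf_map iota by case: ex.
have iota_inj : injective iota by case: ex => _ [_ []].
split; split.
- move=> [I [Iint [_ [a Ia]]]]; split.
    by exists (I \o iota); split; [exact: left_integral_restrict|exists a].
  have [a' [Rint Ra']] := restricted_right_integral ex Iint Ia.
  exact (coflat_cosemisimple ex cf Rint Ra').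
- move=> [[IA [IAint [a IAa]]] /cosemisimple_integral[J [Jint _ J1]]].
  have [I [Iint Iiota]] := left_integral_extend ex IAint Jint J1.
  by exists I; split=> //; split; [exists (iota a)|exists a]; rewrite Iiota.
- move=> /cosemisimple_integral[J [_ Jint J1]]; split.
    apply: (integral_cosemisimple (right_integral_restrict iotaH iota_inj Jint)).
    by rewrite /= (hopf_map1 iotaH).
  apply: (coflat_cosemisimple ex cf (a := 1) Jint).
  by rewrite (hopf_map1 iotaH) J1; apply/eqP; rewrite oner_eq0.
- move=> [/cosemisimple_integral[IA [IAint _ IA1]] /cosemisimple_integral[J [Jint _ J1]]].
  have [I [Iint Iiota]] := left_integral_extend ex IAint Jint J1.
  (* The antipode makes the extension a right integral and fixes [1], so the normalization
     survives. *)
  apply: (integral_cosemisimple (right_integral_anti Iint)).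
  by rewrite /= anti1 -(hopf_map1 iotaH) Iiota.
Qed.
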